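(* The invariant set $\mathcal C^+=\{\bar\xi\in\Xi:\ k\bar s>0\}$ of the system with neighborhoods $\mathcal N_i$ is unstable; i.e., counterclockwise (resp. clockwise) circular formations are unstable when $k>0$ (resp. $k<0$).
   Context: Consider $n\ge 2$ unicycles with positions $z_i\in\mathbb R^2$ and headings $\theta_i$, $\dot z_i=v[\cos\theta_i,\sin\theta_i]^\top$, $\dot\theta_i=\omega_i$, with fixed common forward speed $v>0$, without overlap. For $i\ne j$, $\rho_{ij}=\rho_{ji}>0$ is the distance between $i$ and $j$, and $\alpha_{ij}$ is the bearing (angle) from $i$'s heading to the direction of $z_j-z_i$. Neighborhoods $\mathcal N_i\subset\mathcal I\setminus\{i\}$, $\mathcal I=\{1,\ldots,n\}$, are those of a distance-dependent topology ($j\in\mathcal N_i$ iff $\rho_{ij}\le d$ for a common sensing range $d>0$), but for the equilibrium analysis the topology is assumed static: $\mathcal G=(\mathcal I,\mathcal E)$, $\mathcal E=\{(i,j):i\in\mathcal I, j\in\mathcal N_i\}$, is a fixed undirected connected graph. With gain $k\ne0$, the control law is $$\omega_i=\frac1{|\mathcal N_i|}\sum_{j\in\mathcal N_i}\Big(\frac{2v}{\rho_{ij}}\sin\alpha_{ij}+\frac{k}{\rho_{ij}}(\cos\alpha_{ij}+\cos\alpha_{ji})\Big),$$ and the closed-loop motion equations are, for $i\in\mathcal I$, $j\in\mathcal N_i$, $$\dot\rho_{ij}=-v(\cos\alpha_{ij}+\cos\alpha_{ji}),\qquad \dot\alpha_{ij}=\frac v{\rho_{ij}}(\sin\alpha_{ij}+\sin\alpha_{ji})-\omega_i.$$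 With $n_{\mathsf e}=|\mathcal E|/2$ undirected edges, each contributing the three coordinates $\rho_{ij},\alpha_{ij},\alpha_{ji}$, this is a system $\dot\xi=\hat f(\xi)$ on $\mathbb R^{3n_{\mathsf e}}$, evolving on an invariant $(3n-3)$-dimensional submanifold $\mathcal M\subset\mathbb R^{3n_{\mathsf e}}$ (the relative coordinates realizable by $n$ unicycles). $\Xi=\{\bar\xi\in\mathcal M:\bar\alpha_{ij}+\bar\alpha_{ji}=\pi\bmod2\pi$ and $\exists\bar s$ s.t. $\sin\bar\alpha_{ij}/\bar\rho_{ij}=\bar s$ for all $i\in\mathcal I,\ j\in\mathcal N_i\}$ is a set of equilibria; $\bar s=\bar s(\bar\xi)$ is the common value. When $\bar s\neq0$, $\bar\xi$ corresponds to a circular formation (all unicycles travel along a common circle at the same angular speed), counterclockwise for $\bar s>0$ and clockwise for $\bar s<0$. ''Unstable'' has its standard meaning for invariant sets (not Lyapunov stable). *)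

(* Defs.v *)
From HB Require Import structures.
From mathcomp Require Import all_boot all_order all_algebra.
From mathcomp Require Import all_classical all_reals all_analysis.
Set Implicit Arguments.
Unset Strict Implicit.
Unset Printing Implicit Defensive.
Import Order.TTheory GRing.Theory Num.Theory.
Import numFieldNormedType.Exports.
Local Open Scope classical_set_scope.
Local Open Scope ring_scope.

(* Neighborhoods of a static undirected topology: j is a neighbor of i iff
   e i j. *)
Definition connected_graph (n : nat) (e : rel 'I_n) : Prop :=
  [/\ symmetric e, irreflexive e & forall i j, connect e i j].

(* Edge coordinates (rho, alpha). A point of R^(3 n_e) is stored as a pair of
   n x n matrices with rho symmetric and all entries off the edges equal to 0
   (both imposed in [manifold] below): this leaves one free coordinate rho_ij
   per undirected edge and two, alpha_ij and alpha_ji, per undirected edge.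
   The norm is the max of the entries, equivalent to the Euclidean one.
   Bearings are real numbers, not classes modulo 2 pi. *)
Notation state R n := ('M[R]_n * 'M[R]_n)%type.

Section Unicycles.
Context {R : realType} {n : nat}.
Implicit Types (v k s : R) (e : rel 'I_n) (xi : state R n).

Definition rho xi (i j : 'I_n) : R := xi.1 i j.
Definition alpha xi (i j : 'I_n) : R := xi.2 i j.

(* Unicycle i is at the point z i of the plane, with heading theta i; alpha i j
   is measured counterclockwise from the heading of i to the direction of
   z j - z i. *)
Definition realizes e (z : 'I_n -> R * R) (theta : 'I_n -> R) xi : Prop :=
  forall i j : 'I_n, if e i j then
    let dx := (z j).1 - (z i).1 in
    let dy := (z j).2 - (z i).2 in
    [/\ rho xi i j = Num.sqrt (dx ^+ 2 + dy ^+ 2),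
        dx = rho xi i j * cos (theta i + alpha xi i j) &
        dy = rho xi i j * sin (theta i + alpha xi i j)]
  else rho xi i j = 0 /\ alpha xi i j = 0.

(* Injectivity of z is the absence of overlap, between any two unicycles. *)
Definition manifold e : set (state R n) :=
  [set xi | exists (z : 'I_n -> R * R) (theta : 'I_n -> R),
     injective z /\ realizes e z theta xi].

Definition omega v k e xi (i : 'I_n) : R :=
  #|[set j | e i j]%SET|%:R^-1 *
  \sum_(j | e i j)
     (2 * v / rho xi i j * sin (alpha xi i j)
      + k / rho xi i j * (cos (alpha xi i j) + cos (alpha xi j i))).

Definition rho_dot v xi (i j : 'I_n) : R :=
  - v * (cos (alpha xi i j) + cos (alpha xi j i)).

Definition alpha_dot v k e xi (i j : 'I_n) : R :=
  v / rho xi i j * (sin (alpha xi i j) + sin (alpha xi j i))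
  - omega v k e xi i.

(* Values of [x] outside `[0, T] are irrelevant. *)
Definition is_solution v k e (T : R) (x : R -> state R n) : Prop :=
  [/\ {within `[0, T], continuous x},
      forall t, t \in `[0, T] -> manifold e (x t) &
      forall t, t \in `]0, T[ -> forall i j, e i j ->
        is_derive t 1 (fun u => rho (x u) i j) (rho_dot v (x t) i j) /\
        is_derive t 1 (fun u => alpha (x u) i j) (alpha_dot v k e (x t) i j)].

(* The points at distance less than r from C. *)
Definition neighborhood (C : set (state R n)) (r : R) : set (state R n) :=
  \bigcup_(c in C) ball c r.

(* Solutions may have a bounded maximal interval of existence (distances may
   vanish in finite time), hence the quantification over all compact intervals
   [0, T] on which a solution exists. *)
Definition lyapunov_stable v k e (C : set (state R n)) : Prop :=
  forall eps : R, 0 < eps -> exists2 delta : R, 0 < delta &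
    forall (T : R) (x : R -> state R n), 0 <= T -> is_solution v k e T x ->
      neighborhood C delta (x 0) ->
      forall t, t \in `[0, T] -> neighborhood C eps (x t).

Definition unstable v k e (C : set (state R n)) : Prop :=
  ~ lyapunov_stable v k e C.

Definition common_ratio e xi s : Prop :=
  forall i j, e i j -> sin (alpha xi i j) / rho xi i j = s.

Definition Xi e : set (state R n) :=
  [set xi | [/\ manifold e xi,
     forall i j, e i j -> exists m : int,
       alpha xi i j + alpha xi j i = pi + m%:~R * (2 * pi) &
     exists s, common_ratio e xi s]].

Definition Cplus k e : set (state R n) :=
  [set xi | Xi e xi /\ exists2 s, common_ratio e xi s & 0 < k * s].

Definition counterclockwise_formations e : set (state R n) :=
  [set xi | Xi e xi /\ exists2 s, common_ratio e xi s & 0 < s].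

Definition clockwise_formations e : set (state R n) :=
  [set xi | Xi e xi /\ exists2 s, common_ratio e xi s & s < 0].

End Unicycles.

(* Main.v *)
(* Write a unicycle as a position z_i and a heading phi_i in a plane turning at
   the angular speed v / k. The circular formation of signed radius k, for which
   s = 1 / (2 k), is then a rest point of an ODE on R^(3n), and the trace of the
   Jacobian there is the sum of the d(omega_i)/d(phi_i), that is n / 2 minus the
   sum over i of the mean over j of 2 v cos(alpha_ij) / rho_ij. Reflecting the
   placement of the unicycles on the circle changes the sign of the second term,
   so some formation has a Jacobian of positive trace, hence an eigenvalue of
   positive real part. A Lyapunov-Perron fixed point then gives a nonconstant
   solution on (-oo, T) that tends to the formation at -oo. If the set of
   formations were stable, this solution would stay in its closure, whose points
   are equilibria in the edge coordinates; the solution would then be constant. *)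
Require Import Defs.
From HB Require Import structures.
From mathcomp Require Import all_boot all_order all_algebra.
From mathcomp Require Import all_classical all_reals all_analysis.
From mathcomp Require Import measurable_realfun ring lra.
From mathcomp Require Import complex.
Set Implicit Arguments.
Unset Strict Implicit.
Unset Printing Implicit Defensive.
Import Order.TTheory GRing.Theory Num.Theory.
Import numFieldNormedType.Exports.
Local Open Scope classical_set_scope.
Local Open Scope ring_scope.
Local Notation Re := (@complex.Re _).
Local Notation Im := (@complex.Im _).

(** * Decaying primitives *)

Section RealCalculus.
Context {R : realType}.
Implicit Types (c M : R).

(** Edge coordinates are constrained to a submanifold, while positions and headings are free. In the
    latter the closed loop is an ODE on a vector space, and its trace can be read off entry by
    entry: the velocity of a position coordinate does not involve that coordinate, so only the
    headings contribute. The price is degeneracy. Rotating a formation gives another rest point and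
    translating it gives a periodic motion, so the rest point is neither isolated nor hyperbolic,
    and moving away from it need not mean moving away from the set of formations. A curve with a
    limit at -oo copes with this. Its far past is as close to the formation as desired, so stability
    applied for every eps puts each of its points in the closure of the set. The identities that
    define an equilibrium pass to the closure once the common ratio is eliminated from them. The
    neutral motions are then excluded by the limit at -oo: constant headings are fixed by their
    limit, and a rotating deviation of the positions keeps its length, hence is zero. The sign of
    the bearing-dependent part of the trace is never computed. *)

Lemma exists_between (S T : Type) (f : S -> R) (g : T -> R) (s0 : S) (t0 : T) :
  (forall s t, f s <= g t) ->
  exists L, (forall s, f s <= L) /\ (forall t, L <= g t).
Proof.
move=> fg; exists (sup (range f)); split=> [s|t].
  by apply: ub_le_sup; [exists (g t0) => _ [s' _ <-]|exists s].
by apply: ge_sup; [exists (f s0), s0|move=> _ [s _ <-]].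
Qed.

Lemma is_derive_continuous (f : R -> R) (df t : R) : is_derive t 1 f df -> {for t, continuous f}.
Proof. by move=> [d _]; exact/differentiable_continuous/derivable1_diffP. Qed.

Lemma is_derive_within (f df : R -> R) (A : set R) :
  (forall t : R, is_derive t 1 f (df t)) -> {within A, continuous f}.
Proof.
by move=> d; apply: continuous_subspaceT => t; exact: is_derive_continuous (d t).
Qed.

Lemma is_derive_ge0_homo (f df : R -> R) :
  (forall t : R, is_derive t 1 f (df t)) -> (forall t, 0 <= df t) ->
  {homo f : x y / x <= y}.
Proof.
move=> d p x y xy; rewrite -subr_ge0.
have [|c _ ->] := MVT_segment xy (fun t _ => d t); first exact: is_derive_within d.
by rewrite mulr_ge0// subr_ge0.
Qed.

(** The reflection t -> -t turns the integral into one over a half-line unbounded to the right,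
    where the improper fundamental theorem of calculus applies. *)
Lemma integrable_expR_Ny c u : 0 < c ->
  (@lebesgue_measure R).-integrable `]-oo, u] (EFin \o (fun t => expR (c * t))).
Proof.
move=> c0.
have ce : continuous (fun t : R => expR (c * t)).
  by move=> t; apply: (@is_derive_continuous _ (expR (c * t) * (c * 1))); apply: is_derive1_comp.
apply/integrableP; split.
  by apply/measurable_EFinP; apply: measurable_funTS; exact: continuous_measurable_fun.
under eq_integral do rewrite /= ger0_norm ?expR_ge0//.
rewrite -(opprK u) ge0_integration_by_substitutionNy; last 2 first.
- by apply: continuous_subspaceT.
- by move=> x _; rewrite expR_ge0.
have d (x : R) : is_derive x 1 (fun t : R => - c^-1 * expR (c * - t)) (expR (c * - x)).
  apply: is_derive_eq.
  by rewrite /GRing.scale/=; field; exact: lt0r_neq0.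
rewrite (@ge0_continuous_FTC2y R _ (fun t => - c^-1 * expR (c * - t)) _ 0) ?ltry//.
- by move=> x _ /=; rewrite expR_ge0.
- by apply: continuous_subspaceT => x; apply: continuous_comp; [exact: opp_continuous|exact: ce].
- rewrite -[X in _ --> X](mulr0 (- c^-1)); apply: cvgMr.
  have := @cvgr_expR R.
  have cy : (c * x)%R @[x --> +oo] --> +oo by apply: gt0_cvgMry.
  rewrite (_ : (fun x : R => expR (c * - x)) = (fun x => expR (- x)) \o (fun x => c * x)).
    exact: cvg_comp cy.
  by apply/funext => x /=; rewrite mulrN.
- by apply: cvg_at_right_filter; exact: is_derive_continuous (d _).
- by move=> x _; rewrite derive1E (@derive_val _ _ _ _ _ _ _ (d x)).
Qed.

(** The integral from -oo only supplies some primitive [G0]. With E = (M / c) exp(c t), whose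
    derivative dominates |f|, [G0 + E] increases and [G0 - E] decreases, so a constant L fits
    between them and |G0 - L| <= E. This replaces a computation of the limit of [G0] at -oo. *)
Lemma exists_decaying_primitive (f : R -> R) c M : 0 < c -> continuous f ->
  (forall t, `|f t| <= M * expR (c * t)) ->
  exists G, (forall t : R, is_derive t 1 G (f t)) /\
            forall t, `|G t| <= M / c * expR (c * t).
Proof.
move=> c0 cf fM.
pose G0 x := \int[lebesgue_measure]_(t in `]-oo, x]) f t.
have dG0 (t : R) : is_derive t 1 G0 (f t).
  have intf : (@lebesgue_measure R).-integrable `]-oo, t + 1] (EFin \o f).
    have intM : (@lebesgue_measure R).-integrable `]-oo, t + 1]
        (fun t => (M%:E * (EFin \o (fun t => expR (c * t))) t)%E).
      by apply: integrableZl => //; exact: integrable_expR_Ny.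
    apply: le_integrable intM => //.
      by apply/measurable_EFinP; apply: measurable_funTS; exact: continuous_measurable_fun.
    by move=> x _ /=; rewrite lee_fin (le_trans (fM x))// ler_norm.
  have [] := @continuous_FTC1 R f -oo%O t (t + 1) _ intf _ (cf t).
  - by rewrite ltrDl.
  - by rewrite ltNyr.
  by move=> d e; apply: DeriveDef; [exact: d|rewrite -derive1E; exact: e].
have dE (t : R) : is_derive t 1 (fun t => M / c * expR (c * t)) (M * expR (c * t)).
  by apply: is_derive_eq; rewrite /GRing.scale/=; field; exact: lt0r_neq0.
pose E t := M / c * expR (c * t).
have up : {homo (fun t => G0 t + E t) : x y / x <= y}.
  apply: (@is_derive_ge0_homo _ (fun t => f t + M * expR (c * t))) => // t.
  by have := fM t; rewrite ler_norml -subr_ge0 opprK => /andP[].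
have dn : {homo (fun t => E t - G0 t) : x y / x <= y}.
  apply: (@is_derive_ge0_homo _ (fun t => M * expR (c * t) - f t)) => // t.
  by have := fM t; rewrite ler_norml -[_ <= M * _]subr_ge0 => /andP[].
have E0 t : 0 <= E t.
  have : 0 <= M * expR (c * t) by rewrite (le_trans _ (fM t)).
  by rewrite /E mulrAC => h; rewrite divr_ge0// ltW.
have [L [L1 L2]] : exists L, (forall s, G0 s - E s <= L) /\ (forall t, L <= G0 t + E t).
  apply: exists_between => // s t; have [st|/ltW ts] := leP s t.
    by have := up _ _ st; have := E0 s; lra.
  by have := dn _ _ ts; have := E0 t; lra.
exists (fun t => G0 t - L); split.
  by move=> t; apply: is_derive_eq; rewrite subr0.
by move=> t; rewrite ler_norml; have := L1 t; have := L2 t; rewrite /E; lra.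
Qed.

Lemma is_derive_scale (k df t : R) (f : R -> R) :
  is_derive t 1 f df -> is_derive t 1 (fun u => k * f u) (k * df).
Proof. by move=> d; exact: (@is_deriveZ _ _ _ f k t 1 df d). Qed.

Lemma is_derive_scaler (k df t : R) (f : R -> R) :
  is_derive t 1 f df -> is_derive t 1 (fun u => f u * k) (df * k).
Proof. by move=> d; under eq_fun do rewrite mulrC; rewrite mulrC; exact: is_derive_scale. Qed.

Lemma is_derive_bigsum (I : finType) (t : R) (f : I -> R -> R) (df : I -> R) :
  (forall i, is_derive t 1 (f i) (df i)) ->
  is_derive t 1 (fun u => \sum_i f i u) (\sum_i df i).
Proof.
move=> d.
suff H (s : seq I) : is_derive t 1 (fun u => \sum_(i <- s) f i u) (\sum_(i <- s) df i) by [].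
elim: s => [|i s ih].
  by under eq_fun do rewrite big_nil; rewrite big_nil; exact: is_derive_cst.
by under eq_fun do rewrite big_cons; rewrite big_cons; exact: is_deriveD.
Qed.

End RealCalculus.

(** * Linear systems with decaying forcing *)

Section ComplexLinear.
Context {R : realType} {m : nat}.
Implicit Types (f g : R -> 'rV[R[i]]_m) (B : 'M[R[i]]_m).

(** Complex curves are differentiated through their real and imaginary parts, so that all calculus
    stays with real functions of a real variable. *)
Definition cderive f g := forall (t : R) j,
  is_derive t 1 (fun u => Re (f u 0 j)) (Re (g t 0 j)) /\
  is_derive t 1 (fun u => Im (f u 0 j)) (Im (g t 0 j)).

Definition ccontinuous f := forall j,
  continuous (fun u : R => Re (f u 0 j)) /\ continuous (fun u : R => Im (f u 0 j)).

Definition cbounded (b M : R) f := forall t j,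
  `|Re (f t 0 j)| <= M * expR (b * t) /\ `|Im (f t 0 j)| <= M * expR (b * t).

Lemma cderive_continuous f g : cderive f g -> ccontinuous f.
Proof.
by move=> d j; split=> t; have [dr di] := d t j;
  [exact: is_derive_continuous dr|exact: is_derive_continuous di].
Qed.

Lemma ReD (x y : R[i]) : Re (x + y) = Re x + Re y. Proof. by case: x y => ? ? []. Qed.
Lemma ImD (x y : R[i]) : Im (x + y) = Im x + Im y. Proof. by case: x y => ? ? []. Qed.
Lemma ReM (x y : R[i]) : Re (x * y) = Re x * Re y - Im x * Im y.
Proof. by case: x y => ? ? []. Qed.
Lemma ImM (x y : R[i]) : Im (x * y) = Re x * Im y + Im x * Re y.
Proof. by case: x y => ? ? [? ?] /=. Qed.
Lemma Re_sum (I : Type) (s : seq I) (P : pred I) (F : I -> R[i]) :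
  Re (\sum_(i <- s | P i) F i) = \sum_(i <- s | P i) Re (F i).
Proof. exact: (big_morph _ ReD). Qed.
Lemma Im_sum (I : Type) (s : seq I) (P : pred I) (F : I -> R[i]) :
  Im (\sum_(i <- s | P i) F i) = \sum_(i <- s | P i) Im (F i).
Proof. exact: (big_morph _ ImD). Qed.

Lemma cderiveD f g (u y : R -> 'rV[R[i]]_m) :
  cderive f g -> cderive u y -> cderive (fun t => f t + u t) (fun t => g t + y t).
Proof.
move=> d1 d2 t j; have [d1r d1i] := d1 t j; have [d2r d2i] := d2 t j.
split; rewrite mxE.
  by under eq_fun do rewrite mxE ReD; rewrite ReD; exact: is_deriveD.
by under eq_fun do rewrite mxE ImD; rewrite ImD; exact: is_deriveD.
Qed.

Lemma cderiveM f g B : cderive f g ->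
  cderive (fun t => f t *m B) (fun t => g t *m B).
Proof.
move=> d t j; split; rewrite mxE.
  under eq_fun do (rewrite mxE Re_sum; under eq_bigr do rewrite ReM).
  rewrite Re_sum; under eq_bigr do rewrite ReM.
  apply: is_derive_bigsum => k; have [dr di] := d t k.
  by apply: is_deriveB; exact: is_derive_scaler.
under eq_fun do (rewrite mxE Im_sum; under eq_bigr do rewrite ImM).
rewrite Im_sum; under eq_bigr do rewrite ImM.
apply: is_derive_bigsum => k; have [dr di] := d t k.
by apply: is_deriveD; exact: is_derive_scaler.
Qed.

Lemma cboundedD (b M1 M2 : R) f (u : R -> 'rV[R[i]]_m) :
  cbounded b M1 f -> cbounded b M2 u -> cbounded b (M1 + M2) (fun t => f t + u t).
Proof.
move=> h1 h2 t j; have [h1r h1i] := h1 t j; have [h2r h2i] := h2 t j.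
by rewrite mxE ReD ImD mulrDl; split; rewrite (le_trans (ler_normD _ _))// lerD.
Qed.

(** The factor c depends on B alone; this uniformity in f is what later makes the solution bound
    linear in the size of the forcing. *)
Lemma cboundedM B : exists2 c : R, 0 <= c & forall b M f,
  cbounded b M f -> cbounded b (c * M) (fun t => f t *m B).
Proof.
pose w k j := `|Re (B k j)| + `|Im (B k j)|.
have w0 k j : 0 <= w k j by rewrite addr_ge0.
exists (\sum_j \sum_k w k j); first by apply: sumr_ge0 => j _; apply: sumr_ge0.
move=> b M f h t j.
have M0 : 0 <= M * expR (b * t) by have [h1 _] := h t j; rewrite (le_trans _ h1).
have le1 : \sum_k w k j <= \sum_j \sum_k w k j.
  by rewrite [leRHS](bigD1 j)//= lerDl; apply: sumr_ge0 => j' _; apply: sumr_ge0.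
suff [h1 h2] : `|Re ((f t *m B) 0 j)| <= \sum_k w k j * (M * expR (b * t)) /\
       `|Im ((f t *m B) 0 j)| <= \sum_k w k j * (M * expR (b * t)).
  by split; rewrite -mulrA (le_trans h1, le_trans h2) // -mulr_suml ler_wpM2r.
rewrite mxE Re_sum Im_sum; split.
  apply: le_trans (ler_norm_sum _ _ _) _; apply: ler_sum => k _.
  have [h1 h2] := h t k.
  rewrite ReM (le_trans (ler_normB _ _))// !normrM /w mulrDl.
  by rewrite lerD// mulrC ler_wpM2l.
apply: le_trans (ler_norm_sum _ _ _) _; apply: ler_sum => k _.
have [h1 h2] := h t k.
rewrite ImM (le_trans (ler_normD _ _))// !normrM /w mulrDl.
by rewrite addrC lerD// mulrC ler_wpM2l.
Qed.

(** Variation of constants from -oo: since Re z < b, exp(- z t) g(t) is O(exp((b - Re z) t)) and has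
    a decaying primitive G; take u = exp(z t) G. The factor 4 is 2 * 2: each of the two complex
    products is a sum of two real terms. *)
Lemma exists_scalar_solution (z : R[i]) (b M : R) g :
  Re z < b -> ccontinuous g -> cbounded b M g ->
  exists2 u, cderive u (fun t => z *: u t + g t) &
             cbounded b (4 / (b - Re z) * M) u.
Proof.
move=> zb cg bg.
set a := Re z; set w := Im z.
pose ca (t : R) := cos (w * t); pose sa (t : R) := sin (w * t).
pose ea (t : R) := expR (a * t); pose na (t : R) := expR (- a * t).
have dca (t : R) : is_derive t 1 ca (- w * sa t).
  by apply: is_derive_eq; rewrite /GRing.scale/= /sa; ring.
have dsa (t : R) : is_derive t 1 sa (w * ca t).
  by apply: is_derive_eq; rewrite /GRing.scale/= /ca; ring.
have dea (t : R) : is_derive t 1 ea (a * ea t).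
  by apply: is_derive_eq; rewrite /GRing.scale/= /ea; ring.
have dna (t : R) : is_derive t 1 na (- a * na t).
  by apply: is_derive_eq; rewrite /GRing.scale/= /na; ring.
have cca : continuous ca by move=> t; exact: is_derive_continuous (dca t).
have csa : continuous sa by move=> t; exact: is_derive_continuous (dsa t).
have cna : continuous na by move=> t; exact: is_derive_continuous (dna t).
have en t : ea t * na t = 1 by rewrite /ea /na -expRD mulNr subrr expR0.
have cs t : ca t ^+ 2 + sa t ^+ 2 = 1 by exact: cos2Dsin2.
have ca1 t : `|ca t| <= 1 by rewrite ler_norml cos_geN1 cos_le1.
have sa1 t : `|sa t| <= 1 by rewrite ler_norml sin_geN1 sin_le1.
have bnd2 (c s x y X : R) : `|c| <= 1 -> `|s| <= 1 -> `|x| <= X -> `|y| <= X ->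
    `|c * x + s * y| <= 2 * X.
  move=> c1 s1 xX yX; apply: le_trans (ler_normD _ _) _; rewrite !normrM.
  rewrite (_ : 2 * X = 1 * X + 1 * X); last by ring.
  by rewrite lerD// ler_pM.
have ba0 : 0 < b - a by rewrite subr_gt0.
(* [G.1] and [G.2] are primitives of the real and imaginary parts of exp(- z t) g_j(t). *)
pose P j (G : (R -> R) * (R -> R)) :=
  [/\ forall t : R, is_derive t 1 G.1
        (na t * (ca t * Re (g t 0 j) + sa t * Im (g t 0 j))),
      forall t : R, is_derive t 1 G.2
        (na t * (ca t * Im (g t 0 j) + - sa t * Re (g t 0 j))),
      forall t, `|G.1 t| <= 2 * M / (b - a) * expR ((b - a) * t) &
      forall t, `|G.2 t| <= 2 * M / (b - a) * expR ((b - a) * t)].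
have [G GP] : exists G, forall j, P j (G j).
  suff h j : exists G, P j G by have [G hG] := choice h; exists G.
  have [cr ci] := cg j.
  have nb t (x : R) : `|x| <= 2 * (M * expR (b * t)) ->
      `|na t * x| <= 2 * M * expR ((b - a) * t).
    move=> h; rewrite normrM ger0_norm ?expR_ge0//.
    rewrite (_ : expR ((b - a) * t) = na t * expR (b * t)); last first.
      by rewrite /na -expRD; congr expR; ring.
    rewrite (_ : 2 * M * _ = na t * (2 * (M * expR (b * t)))); last by ring.
    by rewrite ler_wpM2l// expR_ge0.
  have [|t|G1 [d1 b1]] := @exists_decaying_primitive R
    (fun t => na t * (ca t * Re (g t 0 j) + sa t * Im (g t 0 j))) (b - a) (2 * M) ba0.
  - move=> t; apply: cvgM; first exact: cna.
    by apply: cvgD; apply: cvgM; [exact: cca|exact: cr|exact: csa|exact: ci].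
  - by have [h1 h2] := bg t j; apply: nb; apply: bnd2.
  have [|t|G2 [d2 b2]] := @exists_decaying_primitive R
    (fun t => na t * (ca t * Im (g t 0 j) + - sa t * Re (g t 0 j))) (b - a) (2 * M) ba0.
  - move=> t; apply: cvgM; first exact: cna.
    apply: cvgD; apply: cvgM; [exact: cca|exact: ci| |exact: cr].
    by apply: cvgN; exact: csa.
  - by have [h1 h2] := bg t j; apply: nb; apply: bnd2; rewrite ?normrN.
  by exists (G1, G2).
pose ur t j := ea t * (ca t * (G j).1 t + - sa t * (G j).2 t).
pose ui t j := ea t * (ca t * (G j).2 t + sa t * (G j).1 t).
exists (fun t => \row_j Complex (ur t j) (ui t j)) => t j; have [d1 d2 b1 b2] := GP j; split.
- under eq_fun do rewrite mxE /=; rewrite !mxE /=.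
  rewrite ReD ReM /= -/a -/w /ur /ui.
  have d := is_deriveM (dea t) (is_deriveD (is_deriveM (dca t) (d1 t))
     (is_deriveM (is_deriveN (dsa t)) (d2 t))).
  apply: is_derive_eq d _; rewrite /GRing.scale/=.
  set gr := Re _; set gi := Im _.
  have e1 : gr = ea t * na t * (ca t ^+ 2 + sa t ^+ 2) * gr by rewrite en cs !mul1r.
  by rewrite !fctE [in RHS]e1; ring.
- under eq_fun do rewrite mxE /=; rewrite !mxE /=.
  rewrite ImD ImM /= -/a -/w /ur /ui.
  have d := is_deriveM (dea t) (is_deriveD (is_deriveM (dca t) (d2 t))
     (is_deriveM (dsa t) (d1 t))).
  apply: is_derive_eq d _; rewrite /GRing.scale/=.
  set gr := Re _; set gi := Im _.
  have e1 : gi = ea t * na t * (ca t ^+ 2 + sa t ^+ 2) * gi by rewrite en cs !mul1r.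
  by rewrite !fctE [in RHS]e1; ring.
- have e : 4 / (b - a) * M * expR (b * t) =
      ea t * (2 * (2 * M / (b - a) * expR ((b - a) * t))).
    rewrite (_ : expR (b * t) = ea t * expR ((b - a) * t)); first by ring.
    by rewrite /ea -expRD; congr expR; ring.
  rewrite mxE /= /ur; rewrite e normrM ger0_norm ?expR_ge0// ler_wpM2l ?expR_ge0//.
  by apply: bnd2 => //; rewrite normrN.
- have e : 4 / (b - a) * M * expR (b * t) =
      ea t * (2 * (2 * M / (b - a) * expR ((b - a) * t))).
    rewrite (_ : expR (b * t) = ea t * expR ((b - a) * t)); first by ring.
    by rewrite /ea -expRD; congr expR; ring.
  rewrite mxE /= /ui; rewrite e normrM ger0_norm ?expR_ge0// ler_wpM2l ?expR_ge0//.
  exact: bnd2.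
Qed.

End ComplexLinear.

Section LinearSystem.
Context {R : realType}.

(* Each root z of the list contributes one scalar equation u' = z u + r for the
   current residual r; adding u * P to y trades the residual r * P for
   u * ((A - z) * P). *)
Lemma exists_solution_modulo (m : nat) (A : 'M[R[i]]_m.+1) (b : R) (s : seq R[i]) :
  (forall z, z \in s -> Re z < b) ->
  exists2 K : R, 0 <= K & forall (M : R) (g : R -> 'rV[R[i]]_m.+1), 0 <= M ->
    ccontinuous g -> cbounded b M g ->
    exists y r : R -> 'rV[R[i]]_m.+1,
    [/\ cderive y (fun t => y t *m A + g t - r t *m \prod_(z <- s) (A - z%:M)),
        ccontinuous r, cbounded b (K * M) y & cbounded b (K * M) r].
Proof.
elim: s => [_|z s ih zs].
  exists 1 => // M g M0 cg bg; exists (fun=> 0), g; split => //.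
  - move=> t j; rewrite big_nil mulmx1 mul0mx add0r subrr !mxE /=.
    by split; exact: is_derive_cst.
  - by move=> t j; rewrite mxE normr0 mul1r mulr_ge0// expR_ge0.
  - by rewrite mul1r.
have [|K K0 KP] := ih; first by move=> z' z's; apply: zs; rewrite inE z's orbT.
have zb : Re z < b by apply: zs; rewrite inE eqxx.
set P := \prod_(z <- s) (A - z%:M).
have [c c0 cP] := cboundedM P.
pose d := 4 / (b - Re z).
have d0 : 0 <= d by rewrite divr_ge0// subr_ge0 ltW.
have dK0 : 0 <= d * K by rewrite mulr_ge0.
have cdK0 : 0 <= c * (d * K) by rewrite mulr_ge0.
exists (K + c * (d * K) + d * K) => [|M g M0 cg bg].
  by rewrite addr_ge0 ?addr_ge0.
have [y [r [dy cr by_ br]]] := KP M g M0 cg bg.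
have [u du bu] := exists_scalar_solution zb cr br.
exists (fun t => y t + u t *m P), u; split.
- have -> : (fun t => (y t + u t *m P) *m A + g t -
    u t *m \prod_(z0 <- z :: s) (A - z0%:M)) =
    (fun t => (y t *m A + g t - r t *m P) + (z *: u t + r t) *m P).
    apply/funext => t; rewrite big_cons -/P.
    (* P is a product of matrices A - z', hence commutes with A. *)
    have PA : (A - z%:M) *m P = P *m A - z *: P.
      rewrite mulmxBl mul_scalar_mx; congr (_ - _).
      rewrite /P; elim: (s) => [|z' s' ih']; first by rewrite big_nil mulmx1 mul1mx.
      rewrite big_cons -[_ * _]/(_ *m _) mulmxA -[RHS]mulmxA -ih' mulmxA; congr (_ *m _).
      by rewrite mulmxBr mulmxBl scalar_mxC.
    rewrite -[(A - z%:M) * P]/((A - z%:M) *m P) PA.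
    rewrite mulmxBr !mulmxDl -scalemxAr -scalemxAl mulmxA.
    rewrite opprB (addrAC (y t *m A)) -(addrA (y t *m A + g t)) (addrC (u t *m P *m A)) subrK.
    by rewrite [in RHS](addrC (z *: _)) addrA subrK.
  exact: cderiveD dy (cderiveM P du).
- exact: cderive_continuous du.
- have := cboundedD by_ (cP _ _ _ bu).
  move=> h t j; have [h1 h2] := h t j.
  have e : (K * M + c * (d * (K * M))) * expR (b * t) <=
           (K + c * (d * K) + d * K) * M * expR (b * t).
    rewrite ler_wpM2r ?expR_ge0// [leRHS]mulrDl.
    have := mulr_ge0 dK0 M0; lra.
  by split; apply: le_trans e.
- move=> t j; have [h1 h2] := bu t j.
  have e : d * (K * M) * expR (b * t) <=
           (K + c * (d * K) + d * K) * M * expR (b * t).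
    rewrite ler_wpM2r ?expR_ge0// mulrA ler_wpM2r//.
    by rewrite lerDr addr_ge0.
  by split; apply: le_trans e.
Qed.

(* The residual vanishes by Cayley-Hamilton once s exhausts the eigenvalues. *)
Lemma exists_bounded_solution (m : nat) (A : 'M[R]_m.+1) (b : R) (s : seq R[i]) :
  char_poly (map_mx (real_complex R) A) = \prod_(z <- s) ('X - z%:P) ->
  (forall z, z \in s -> Re z < b) ->
  exists2 K : R, 0 <= K & forall (M : R) (g : R -> 'rV[R]_m.+1), 0 <= M ->
    (forall j, continuous (fun t : R => g t 0 j)) ->
    (forall t j, `|g t 0 j| <= M * expR (b * t)) ->
    exists h : R -> 'rV[R]_m.+1,
     (forall (t : R) j, is_derive t 1 (fun u => h u 0 j) ((h t *m A + g t) 0 j)) /\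
     (forall t j, `|h t 0 j| <= K * M * expR (b * t)).
Proof.
move=> charA sb; have [K K0 KP] := exists_solution_modulo (map_mx (real_complex R) A) sb.
exists K => // M g M0 cg bg.
have [||y [r [dy _ by_ _]]] := KP M (fun t => map_mx (real_complex R) (g t)) M0.
- move=> j; split.
    by rewrite (_ : (fun _ => _) = fun t : R => g t 0 j)//; apply/funext => t; rewrite mxE.
  by under eq_fun do rewrite mxE /=; exact: cst_continuous.
- move=> t j; rewrite mxE /= normr0; split; first exact: bg.
  by rewrite mulr_ge0// expR_ge0.
have prod0 : \prod_(z <- s) (map_mx (real_complex R) A - z%:M) = 0.
  rewrite -(Cayley_Hamilton (map_mx (real_complex R) A)) charA rmorph_prod /=.
  by apply: eq_bigr => z _; rewrite rmorphB /= horner_mx_X horner_mx_C.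
(* A and g are real, so the real part of a complex solution is again a solution. *)
exists (fun t => \row_j Re (y t 0 j)); split => t j; last first.
  by rewrite mxE; have [] := by_ t j.
have [d _] := dy t j; under eq_fun do rewrite mxE.
apply: is_derive_eq d _; rewrite prod0 mulmx0 subr0 !mxE ReD /= Re_sum; congr (_ + _).
by apply: eq_bigr => k _; rewrite ReM !mxE /= mulr0 subr0.
Qed.

End LinearSystem.

(** * An eigenvalue of largest real part *)

Section UnstableEigenvector.
Context {R : realType}.

Lemma exists_max_Re (s : seq R[i]) : s != [::] ->
  exists2 z, z \in s & forall z', z' \in s -> Re z' <= Re z.
Proof.
elim: s => // z [|z1 s] ih _.
  by exists z; rewrite ?inE// => z'; rewrite inE => /eqP ->.
have [//|w ws wm] := ih; have [zw|wz] := leP (Re z) (Re w).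
  exists w; first by rewrite in_cons ws orbT.
  by move=> z'; rewrite in_cons => /predU1P[->//|/wm].
exists z; first exact: mem_head.
move=> z'; rewrite in_cons => /predU1P[->//|/wm h].
by rewrite (le_trans h)// ltW.
Qed.

(** The trace is the sum of the complex eigenvalues, so the largest real part a is positive. The
    rows p and q are the real and imaginary parts of a left eigenvector for a + i w. *)
Lemma exists_unstable_eigenvector (m : nat) (A : 'M[R]_m.+1) : 0 < \tr A ->
  exists (s : seq R[i]) (a w : R) (p q : 'rV[R]_m.+1),
  [/\ char_poly (map_mx (real_complex R) A) = \prod_(z <- s) ('X - z%:P),
      0 < a, forall z, z \in s -> Re z <= a,
      p != 0 &
      p *m A = a *: p - w *: q /\ q *m A = w *: p + a *: q].
Proof.
move=> trA; set Ac := map_mx (real_complex R) A.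
have [s] := closed_field_poly_normal (char_poly Ac).
rewrite (monicP (char_poly_monic Ac)) scale1r => charA.
have szs : size s = m.+1.
  by have := size_char_poly Ac; rewrite charA size_prod_XsubC => -[].
have sum : \sum_(z <- s) z = (\tr A)%:C%C.
  have := @coefPn_prod_XsubC _ s; rewrite szs -charA char_poly_trace// => /(_ isT)/oppr_inj <-.
  by rewrite /mxtrace rmorph_sum; apply: eq_bigr => i _; rewrite mxE.
have s0 : s != [::] by rewrite -size_eq0 szs.
have [z zs zm] := exists_max_Re s0.
have a0 : 0 < Re z.
  rewrite ltNge; apply/negP => z0.
  have : Re (\sum_(z <- s) z) <= 0.
    rewrite Re_sum big_seq; apply: sumr_le0 => z' /zm h; exact: le_trans h z0.
  by rewrite sum /= leNgt trA.
have /eigenvalueP[x xA x0] : eigenvalue Ac z.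
  by rewrite eigenvalue_root_char charA root_prod_XsubC.
pose p : 'rV[R]_m.+1 := \row_j Re (x 0 j); pose q : 'rV[R]_m.+1 := \row_j Im (x 0 j).
have pA : p *m A = Re z *: p - Im z *: q.
  apply/rowP => j; have := congr1 (fun y : 'rV_m.+1 => y 0 j) xA; rewrite !mxE.
  move=> /(congr1 (fun z => Re z)); rewrite Re_sum ReM => <-.
  by apply: eq_bigr => k _; rewrite ReM !mxE /= mulr0 subr0.
have qA : q *m A = Im z *: p + Re z *: q.
  apply/rowP => j; have := congr1 (fun y : 'rV_m.+1 => y 0 j) xA; rewrite !mxE.
  move=> /(congr1 (fun z => Im z)); rewrite Im_sum ImM => h; rewrite [RHS]addrC -h.
  by apply: eq_bigr => k _; rewrite ImM !mxE /= mulr0 add0r.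
have [p0|p0] := eqVneq p 0; last by exists s, (Re z), (Im z), p, q.
(* If the real part vanishes, multiply the eigenvector by - i, which turns (p, q) into (q, - p). *)
exists s, (Re z), (Im z), q, (- p); split => //.
  apply: contra_neq x0 => q0; apply/rowP => j; rewrite mxE.
  have := congr1 (fun y : 'rV_m.+1 => y 0 j) p0.
  have := congr1 (fun y : 'rV_m.+1 => y 0 j) q0; rewrite !mxE.
  by case: (x 0 j) => ? ? /= -> ->.
by rewrite mulNmx pA qA scalerN opprK addrC scalerN opprB; split=> //; rewrite addrC.
Qed.

End UnstableEigenvector.

(** * Curves emanating from an unstable rest point *)

Section UnstableCurve.
Context {R : realType}.

Lemma exists_small_geometric (C e : R) : 0 < e -> exists k, C / 2 ^+ k <= e.
Proof.
move=> e0; exists (Num.bound (C / e)).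
rewrite ler_pdivrMr ?exprn_gt0// mulrC -ler_pdivrMr//.
apply: le_trans (ler_norm _) _; apply: le_trans (ltW (archi_boundP (normr_ge0 _))) _.
rewrite -natrX ler_nat; apply: leq_trans (ltnW (ltn_expl _ (ltnSn 1))) _.
by rewrite leq_exp2l//; rewrite /Num.bound normr_id.
Qed.

(** With e k = 2 C / 2^k, the step bound says that u + e decreases and u - e increases; the constant
    between them is the limit, and the rate comes for free. *)
Lemma exists_geometric_limit (u : nat -> R) (C : R) :
  (forall k, `|u k.+1 - u k| <= C / 2 ^+ k) ->
  exists L, forall k, `|u k - L| <= 2 * C / 2 ^+ k.
Proof.
move=> uC; pose e k := 2 * C / 2 ^+ k.
have eS k : e k.+1 = e k - C / 2 ^+ k.
  by rewrite /e exprS; field; rewrite expf_neq0.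
have C0 : 0 <= C by have := uC 0%N; rewrite expr0 divr1; exact: le_trans.
have e0 k : 0 <= e k by rewrite divr_ge0 ?exprn_ge0// mulr_ge0.
have dec : {homo (fun k => u k + e k) : i j / (i <= j)%N >-> j <= i}.
  apply: homo_leq => [?//|y x z xy yz|k]; first exact: le_trans yz xy.
  by have := uC k; rewrite eS ler_norml => /andP[]; lra.
have inc : {homo (fun k => u k - e k) : i j / (i <= j)%N >-> i <= j}.
  apply: homo_leq => [?//|y x z xy yz|k]; first exact: le_trans xy yz.
  by have := uC k; rewrite eS ler_norml => /andP[]; lra.
have [L [L1 L2]] : exists L, (forall k, u k - e k <= L) /\ (forall k, L <= u k + e k).
  apply: exists_between 0%N 0%N _ => i j; have [ij|/ltnW ji] := leqP i j.
    by have := inc _ _ ij; have := e0 j; lra.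
  by have := dec _ _ ji; have := e0 i; lra.
exists L => k; rewrite ler_norml; have := L1 k; have := L2 k; rewrite /e; lra.
Qed.

(** As E is nondecreasing, both convergences are uniform on (-oo, t + 1]. The mean value theorem
    bounds the increments of f_i around t uniformly in i, and i then tends to infinity. *)
Lemma is_derive_limit (f : nat -> R -> R) (g : nat -> R -> R) (f0 g0 E : R -> R) :
  {homo E : x y / x <= y} ->
  (forall k (t : R), is_derive t 1 (f k) (g k t)) -> (forall k, continuous (g k)) ->
  (forall k t, `|f k t - f0 t| <= E t / 2 ^+ k) ->
  (forall k t, `|g k t - g0 t| <= E t / 2 ^+ k) ->
  forall t : R, is_derive t 1 f0 (g0 t).
Proof.
move=> Ei df cg ff gg t.
apply/is_derive1_caratheodory.
exists (fun y => if y == t then g0 t else (f0 y - f0 t) / (y - t)).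
split; [| |by rewrite eqxx].
  move=> z; case: eqVneq => [->|zt]; first by rewrite !subrr mulr0.
  by rewrite divfK// subr_eq0.
apply/cvgrPdist_le => e e0; rewrite eqxx.
(* Four quarters: g_i to g0 at s, g0 to g_k at s, g_k from s to t, and g_k to g0 at t. *)
have e40 : 0 < e / 4 by rewrite divr_gt0.
have [k kE] := exists_small_geometric (E (t + 1)) e40.
have kE' i s : (k <= i)%N -> s <= t + 1 -> E s / 2 ^+ i <= e / 4.
  move=> ki st; apply: le_trans kE.
  have E0 : 0 <= E s by have := ff 0%N s; rewrite expr0 divr1; exact: le_trans.
  rewrite ler_pM ?invr_ge0 ?exprn_ge0 ?Ei// lef_pV2 ?posrE ?exprn_gt0//.
  by rewrite ler_eXn2l ?ltr1n.
have /cvgrPdist_le/(_ _ e40)/nbhs_ballP[d /= d0 dP] := cg k t.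
apply/nbhs_ballP; exists (Num.min d 1); first by rewrite /= lt_min d0 ltr01.
move=> y; rewrite /ball /= lt_min => /andP[ytd' yt1].
case: eqVneq => [_|yt]; first by rewrite subrr normr0 ltW.
have ytd : 0 < `|y - t| by rewrite normr_gt0 subr_eq0.
suff H : `|f0 y - f0 t - g0 t * (y - t)| <= e * `|y - t|.
  by rewrite distrC -(ler_pM2r ytd) -normrM mulrBl divfK ?subr_eq0.
have gs i s : (k <= i)%N -> `|t - s| < d -> `|t - s| < 1 -> `|g i s - g0 t| <= e.
  move=> ki sd s1; have st : s <= t + 1 by move: s1; rewrite ltr_norml; lra.
  have tt1 : t <= t + 1 by lra.
  have := le_trans (gg i s) (kE' _ _ ki st); have := le_trans (gg k s) (kE' _ _ (leqnn k) st).
  have := le_trans (gg k t) (kE' _ _ (leqnn k) tt1); have := dP s sd.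
  by rewrite /= !ler_norml; lra.
have fi i : (k <= i)%N -> `|f i y - f i t - g0 t * (y - t)| <= e * `|y - t|.
  move=> ki.
  suff [c ct ->] : exists2 c, `|t - c| <= `|t - y| & f i y - f i t = g i c * (y - t).
    rewrite -mulrBl normrM ler_wpM2r//.
    by apply: gs => //; apply: le_lt_trans ct _.
  have [ty|/ltW yt'] := leP t y.
    have [|c cty ->] := MVT_segment ty (fun s _ => df i s).
      exact: is_derive_within (df i).
    exists c => //; move: cty; rewrite in_itv /= => /andP[tc cy].
    by rewrite !ler0_norm; lra.
  have [|c cty h] := MVT_segment yt' (fun s _ => df i s).
    exact: is_derive_within (df i).
  exists c; last by rewrite -opprB h; ring.
  move: cty; rewrite in_itv /= => /andP[tc cy].
  by rewrite !ger0_norm; lra.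
(* The slack r pays for replacing f0 by a late f_i at the two points y and t, now fixed. *)
apply/ler_addgt0Pr => r r0.
have r20 : 0 < r / 2 by rewrite divr_gt0.
have [i1 iy] := exists_small_geometric (E (t + 1)) r20.
have kE2 s : s <= t + 1 -> E s / 2 ^+ (maxn k i1) <= r / 2.
  move=> st; apply: le_trans iy.
  have E0 : 0 <= E s by have := ff 0%N s; rewrite expr0 divr1; exact: le_trans.
  rewrite ler_pM ?invr_ge0 ?exprn_ge0 ?Ei// lef_pV2 ?posrE ?exprn_gt0//.
  by rewrite ler_eXn2l ?ltr1n// leq_maxr.
have yt1' : y <= t + 1 by move: yt1; rewrite ltr_norml; lra.
have tt1 : t <= t + 1 by lra.
have := fi _ (leq_maxl k i1).
have := le_trans (ff (maxn k i1) y) (kE2 _ yt1').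
have := le_trans (ff (maxn k i1) t) (kE2 _ tt1).
by rewrite !ler_norml; lra.
Qed.

(* Lyapunov-Perron iteration, contracting for the norm sup_t exp(- b t) |h t|. *)
Lemma exists_fixed_curve (m : nat) (A : 'M[R]_m.+1) (b K L M : R)
    (N : 'rV[R]_m.+1 -> 'rV[R]_m.+1) (x : R -> 'rV[R]_m.+1) :
  (forall (M : R) (g : R -> 'rV[R]_m.+1), 0 <= M ->
    (forall j, continuous (fun t : R => g t 0 j)) ->
    (forall t j, `|g t 0 j| <= M * expR (b * t)) ->
    exists h : R -> 'rV[R]_m.+1,
     (forall (t : R) j, is_derive t 1 (fun u => h u 0 j) ((h t *m A + g t) 0 j)) /\
     (forall t j, `|h t 0 j| <= K * M * expR (b * t))) ->
  0 <= b -> 0 <= K -> 0 <= L -> K * L <= 1 / 2 -> 0 <= M ->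
  (forall (h h' : 'rV[R]_m.+1) (D : R), (forall j, `|h 0 j - h' 0 j| <= D) ->
     forall j, `|N h 0 j - N h' 0 j| <= L * D) ->
  (forall j, continuous (fun t => x t 0 j)) ->
  (forall t j, `|N (x t) 0 j| <= M * expR (b * t)) ->
  exists h : R -> 'rV[R]_m.+1,
   (forall (t : R) j, is_derive t 1 (fun u => h u 0 j) ((h t *m A + N (x t + h t)) 0 j)) /\
   (forall t j, `|h t 0 j| <= 2 * (K * M) * expR (b * t)).
Proof.
move=> S b0 K0 L0 KL M0 NL cx Nx.
have cN (h : R -> 'rV[R]_m.+1) : (forall j, continuous (fun t => h t 0 j)) ->
    forall j, continuous (fun t => N (h t) 0 j).
  move=> ch j t; apply/cvgrPdist_le => e e0.
  have eL : 0 < e / (L + 1) by rewrite divr_gt0// ltr_wpDl.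
  have cc i : \forall s \near nbhs t, `|h t 0 i - h s 0 i| <= e / (L + 1).
    by have /cvgrPdist_le/(_ _ eL) := ch i t.
  change (\forall s \near nbhs t, `|N (h t) 0 j - N (h s) 0 j| <= e).
  apply: filterS (filter_forall _ cc) => s hs; apply: le_trans (NL _ _ _ hs j) _.
  by rewrite mulrA ler_pdivrMr ?ltr_wpDl// (mulrC L) ler_wpM2l ?(ltW e0)// lerDl.
have cD (f g : R -> R) : continuous f -> continuous g -> continuous (fun t => f t + g t).
  by move=> cf cg t; apply: cvgD; [exact: cf|exact: cg].
have cB (f g : R -> R) : continuous f -> continuous g -> continuous (fun t => f t - g t).
  by move=> cf cg t; apply: cvgB; [exact: cf|exact: cg].
have cxD (h : R -> 'rV[R]_m.+1) : (forall j, continuous (fun t => h t 0 j)) ->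
    forall j, continuous (fun t => (x t + h t) 0 j).
  by move=> ch j; under eq_fun do rewrite mxE; exact: cD.
pose E t := K * M * expR (b * t).
have E0 t : 0 <= E t by rewrite !mulr_ge0// expR_ge0.
(* The hypothesis on the linear system gives existence only, not a linear solution operator. Hence
   the next iterate is the current one plus a solution for the difference of the last two forcings,
   and the invariant concerns pairs of consecutive iterates. *)
pose Inv k (p : (R -> 'rV[R]_m.+1) * (R -> 'rV[R]_m.+1)) :=
  [/\ forall j, continuous (fun t => p.1 t 0 j),
      forall j, continuous (fun t => p.2 t 0 j),
      forall (t : R) j, is_derive t 1 (fun u => p.2 u 0 j)
        ((p.2 t *m A + N (x t + p.1 t)) 0 j) &
      forall t j, `|p.2 t 0 j - p.1 t 0 j| <= E t / 2 ^+ k].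
have [f fP] : exists f : nat * ((R -> 'rV[R]_m.+1) * (R -> 'rV[R]_m.+1)) ->
    (R -> 'rV[R]_m.+1), forall kp, Inv kp.1 kp.2 -> Inv kp.1.+1 (kp.2.2, f kp).
  suff step kp : exists h, Inv kp.1 kp.2 -> Inv kp.1.+1 (kp.2.2, h).
    by have [f fP] := choice step; exists f.
  case: kp => k [h0 h1] /=.
  have [[/= c0 c1 d1 h01]|nI] := pselect (Inv k (h0, h1)); last by exists h0.
  have LK0 : 0 <= L * (K * M / 2 ^+ k) by rewrite !mulr_ge0// invr_ge0 exprn_ge0.
  have [||g [dg bg]] := S _ (fun t => N (x t + h1 t) - N (x t + h0 t)) LK0.
  - by move=> j; under eq_fun do rewrite !mxE; apply: cB; apply: cN; exact: cxD.
  - move=> t j; rewrite !mxE.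
    have := NL (x t + h1 t) (x t + h0 t) (E t / 2 ^+ k).
    rewrite (_ : L * _ = L * (K * M / 2 ^+ k) * expR (b * t)); last by rewrite /E; ring.
    by apply => i; rewrite !mxE opprD addrACA subrr add0r.
  have dh (t : R) j : is_derive t 1 (fun u => (h1 u + g u) 0 j)
     (((h1 t + g t) *m A + N (x t + h1 t)) 0 j).
    under eq_fun do rewrite mxE.
    apply: is_derive_eq (is_deriveD (d1 t j) (dg t j)) _.
    by rewrite mulmxDl !mxE; ring.
  exists (fun t => h1 t + g t) => _; split => //=.
  - by move=> j t; exact: is_derive_continuous (dh t j).
  - move=> t j; rewrite mxE (_ : _ - _ = g t 0 j); last by ring.
    apply: le_trans (bg t j) _.
    rewrite (_ : K * _ * _ = (K * L) * (E t / 2 ^+ k)); last by rewrite /E; ring.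
    have -> : E t / 2 ^+ k.+1 = 1 / 2 * (E t / 2 ^+ k).
      by rewrite exprS; field; rewrite expf_neq0.
    by rewrite ler_wpM2r// divr_ge0// exprn_ge0.
have [h1 [d1 b1]] := S M (fun t => N (x t)) M0 (cN _ cx) Nx.
pose u := fix u k := if k is k'.+1 then ((u k').2, f (k', u k')) else ((fun=> 0), h1).
have uI k : Inv k (u k).
  elim: k => [|k ih]; last exact: (fP (k, u k) ih).
  split=> /=.
  - by move=> j; under eq_fun do rewrite mxE; exact: cst_continuous.
  - by move=> j t; exact: is_derive_continuous (d1 t j).
  - by move=> t j; rewrite addr0.
  - by move=> t j; rewrite mxE subr0 expr0 divr1.
pose H k := (u k).2.
have HS k t j : `|H k.+1 t 0 j - H k t 0 j| <= E t / 2 / 2 ^+ k.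
  have [_ _ _ h] := uI k.+1; apply: le_trans (h t j) _.
  by rewrite exprS invfM mulrA.
have [h hP] : exists h : R -> 'rV[R]_m.+1, forall t j k,
    `|H k t 0 j - h t 0 j| <= E t / 2 ^+ k.
  have step (tj : R * 'I_m.+1) := exists_geometric_limit (fun k => HS k tj.1 tj.2).
  have [l lP] := choice step; exists (fun t => \row_j l (t, j)) => t j k.
  rewrite mxE; apply: le_trans (lP (t, j) k) _.
  by rewrite /= (_ : 2 * (E t / 2) = E t)//; field.
exists h; split; last first.
  move=> t j; have := hP t j 0%N; have := b1 t j; rewrite expr0 divr1 /H /= -/(E t).
  rewrite (_ : 2 * _ * _ = 2 * E t); last by rewrite /E; ring.
  by rewrite !ler_norml; lra.
move=> t j.
pose a := \sum_i \sum_j `|A i j|.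
have a0 : 0 <= a by apply: sumr_ge0 => i _; apply: sumr_ge0.
(* Here a controls the linear part of the derivative and L the nonlinear one; the 1 makes C >= 1, so
   that C E also bounds the distance of the iterates themselves. *)
pose C := a + L + 1.
apply: (@is_derive_limit (fun k t => H k.+1 t 0 j)
  (fun k t => (H k.+1 t *m A + N (x t + H k t)) 0 j) _
  (fun t => (h t *m A + N (x t + h t)) 0 j) (fun t => C * E t)).
- move=> s s' ss'; rewrite ler_wpM2l ?addr_ge0// ler_wpM2l ?mulr_ge0//.
  by rewrite ler_expR ler_wpM2l.
- by move=> k s; have [_ _ d _] := uI k.+1; exact: d.
- move=> k; have [_ _ d _] := uI k.+1; have [_ ck _ _] := uI k.
  under eq_fun do rewrite mxE; apply: cD; last exact: (cN _ (cxD _ ck)).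
  under eq_fun do rewrite mxE; move=> s.
  exact: is_derive_continuous (is_derive_bigsum (fun i => is_derive_scaler (A i j) (d s i))).
- move=> k s; apply: le_trans (hP s j k.+1) _.
  rewrite ler_pM ?invr_ge0 ?exprn_ge0//.
    by rewrite ler_peMl// /C; lra.
  by rewrite lef_pV2 ?posrE ?exprn_gt0// ler_eXn2l ?ltr1n.
- move=> k s; rewrite !mxE.
  have h1' : `|N (x s + H k s) 0 j - N (x s + h s) 0 j| <= L * (E s / 2 ^+ k).
    by apply: NL => i; rewrite !mxE opprD addrACA subrr add0r.
  have h2' : `|\sum_j0 H k.+1 s 0 j0 * A j0 j - \sum_j0 h s 0 j0 * A j0 j| <= a * (E s / 2 ^+ k).
    rewrite -sumrB; apply: le_trans (ler_norm_sum _ _ _) _.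
    rewrite mulr_suml; apply: ler_sum => i _.
    rewrite -mulrBl normrM mulrC ler_pM//.
      by rewrite (bigD1 j)//= lerDl; apply: sumr_ge0.
    apply: le_trans (hP s i k.+1) _; rewrite ler_wpM2l//.
    by rewrite lef_pV2 ?posrE ?exprn_gt0// ler_eXn2l ?ltr1n.
  rewrite opprD addrACA; apply: le_trans (ler_normD _ _) _.
  apply: le_trans (lerD h2' h1') _; rewrite -mulrDl mulrA ler_wpM2r ?invr_ge0 ?exprn_ge0//.
  by rewrite ler_wpM2r// /C; lra.
Qed.

Lemma exists_expR_small (a e : R) : 0 < a -> 0 < e ->
  exists T, forall t, t <= T -> expR (a * t) <= e.
Proof.
move=> a0 e0; exists (ln e / a) => t tT.
by rewrite -[leRHS]lnK ?posrE// ler_expR mulrC -ler_pdivlMr.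
Qed.

(** Times arbitrarily far in the past at which the linear part of the unstable curve is exactly
    exp(a t) p, whatever q is. *)
Lemma exists_full_period (w T : R) :
  exists t, [/\ t < T, cos (w * t) = 1 & sin (w * t) = 0].
Proof.
have [->|w0] := eqVneq w 0.
  by exists (T - 1); rewrite mul0r cos0 sin0; split=> //; rewrite ltrBlDr ltrDl.
have aw0 : 0 < `|w| by rewrite normr_gt0.
have p0 : 0 < pi *+ 2 / `|w| by rewrite divr_gt0// mulrn_wgt0// pi_gt0.
pose N := Num.bound `|T / (pi *+ 2 / `|w|)|.
have cN : cos (pi *+ 2 *+ N) = 1 :> R by rewrite -[_ *+ N]add0r periodicn ?cos0//; exact: cosD2pi.
have sN : sin (pi *+ 2 *+ N) = 0 :> R by rewrite -[_ *+ N]add0r periodicn ?sin0//; exact: sinD2pi.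
exists (- (pi *+ 2 / `|w| * N%:R)).
have tT : - (pi *+ 2 / `|w| * N%:R) < T.
  rewrite ltrNl mulrC -ltr_pdivrMr// mulNr.
  by apply: le_lt_trans (archi_boundP (normr_ge0 _)); rewrite -normrN ler_norm.
split=> //; have [w1|w1] := ltrP 0 w.
- rewrite gtr0_norm// (_ : w * _ = - (pi *+ 2 *+ N)) ?cosN//.
  by rewrite -mulr_natr; field.
- rewrite ler0_norm// (_ : w * _ = pi *+ 2 *+ N)//.
  by rewrite -mulr_natr; field.
- rewrite gtr0_norm// (_ : w * _ = - (pi *+ 2 *+ N)) ?sinN ?sN ?oppr0//.
  by rewrite -mulr_natr; field.
- rewrite ler0_norm// (_ : w * _ = pi *+ 2 *+ N)//.
  by rewrite -mulr_natr; field.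
Qed.

Definition clip (d x : R) := Num.max (- d) (Num.min d x).

Lemma clip_cases (d x : R) : 0 <= d ->
  [\/ x <= - d /\ clip d x = - d, (- d <= x /\ x <= d) /\ clip d x = x |
      d <= x /\ clip d x = d].
Proof.
move=> d0; rewrite /clip; have [dx|/ltW dx] := leP d x.
  by apply: Or33; split=> //; rewrite max_r// lerNl (le_trans _ d0)// oppr_le0.
have [nx|/ltW nx] := leP (- d) x; first by apply: Or32; split=> //; rewrite max_r.
by apply: Or31; split.
Qed.

Lemma clip_le (d x : R) : 0 <= d -> `|clip d x| <= d.
Proof. by move=> d0; rewrite ler_norml; have [[? ->]|[? ->]|[? ->]] := clip_cases x d0; lra. Qed.

Lemma clip_le_norm (d x : R) : 0 <= d -> `|clip d x| <= `|x|.
Proof.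
move=> d0; have := ler_norm x; have := ler_norm (- x); rewrite normrN => h1 h2; rewrite ler_norml.
by have [[? ->]|[? ->]|[? ->]] := clip_cases x d0; lra.
Qed.

Lemma clip_lipschitz (d x y : R) : 0 <= d -> `|clip d x - clip d y| <= `|x - y|.
Proof.
move=> d0; have := ler_norm (x - y); have := ler_norm (- (x - y)).
rewrite normrN => h1 h2; rewrite ler_norml.
by have [[? ->]|[? ->]|[? ->]] := clip_cases x d0;
  have [[? ->]|[? ->]|[? ->]] := clip_cases y d0; lra.
Qed.

(* The curve is x0 + exp(a t) Re (exp(i w t) (p + i q)) + h t, with a + i w an
   eigenvalue of largest real part and h = O(exp(2 a t)). Truncating the
   remainder by clip makes the iteration for h globally contracting, and the
   truncation is inactive near -oo. *)
Lemma exists_unstable_curve (m : nat) (F : 'rV[R]_m -> 'rV[R]_m) (x0 : 'rV[R]_m)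
    (A : 'M[R]_m) (K d0 : R) : 0 < d0 -> F x0 = 0 ->
  (forall (h h' : 'rV[R]_m) (d D : R), d <= d0 ->
    (forall j, `|h 0 j| <= d) -> (forall j, `|h' 0 j| <= d) ->
    (forall j, `|h 0 j - h' 0 j| <= D) ->
    forall j, `|F (x0 + h) 0 j - F (x0 + h') 0 j - ((h - h') *m A) 0 j| <= K * d * D) ->
  0 < \tr A ->
  exists (x : R -> 'rV[R]_m) (T : R),
  [/\ forall t : R, t < T -> forall j, is_derive t 1 (fun u => x u 0 j) (F (x t) 0 j),
      forall e : R, 0 < e -> exists T' : R, forall t : R, t < T' -> forall j, `|x t 0 j - x0 0 j| <= e &
      forall T', exists2 t, t < T' & x t != x0].
Proof.
move=> d0_gt0 Fx0 FA trA.
case: m F x0 A Fx0 FA trA => [|m] F x0 A Fx0 FA trA.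
  by move: trA; rewrite /mxtrace big_ord0 ltxx.
have [s [a [w [p [q [charA a0 sa pn0 [pA qA]]]]]]] := exists_unstable_eigenvector trA.
(* The rate 2 a exceeds every real part, as the linear theory requires, and it is the rate of a
   quadratic remainder along a curve of size exp(a t). *)
have sb z : z \in s -> Re z < 2 * a by move=> /sa h; apply: le_lt_trans h _; lra.
have [S S0 SP] := exists_bounded_solution charA sb.
pose K' : R := `|K|; have K'0 : 0 <= K' by exact: normr_ge0.
(* On the ball of radius d the remainder has Lipschitz constant K' d, and S K' d <= 1 / 2 makes the
   iteration contract. *)
pose d := Num.min d0 (1 / 2 / (S * K' + 1)).
have SK0 : 0 < S * K' + 1 by rewrite ltr_wpDl// mulr_ge0.
have d_gt0 : 0 < d by rewrite lt_min d0_gt0/= divr_gt0.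
have dd0 : d <= d0 by rewrite ge_min lexx.
have SKd : S * (K' * d) <= 1 / 2.
  have : d * (S * K' + 1) <= 1 / 2 by rewrite -ler_pdivlMr// ge_min lexx orbT.
  have : 0 <= d by exact: ltW.
  lra.
pose N h := F (x0 + h) - h *m A.
have NP (h h' : 'rV[R]_m.+1) (e D : R) : e <= d0 ->
    (forall j, `|h 0 j| <= e) -> (forall j, `|h' 0 j| <= e) ->
    (forall j, `|h 0 j - h' 0 j| <= D) ->
    forall j, `|N h 0 j - N h' 0 j| <= K' * e * D.
  move=> ed he he' hD j.
  have e0 : 0 <= e by exact: le_trans (he j).
  have D0 : 0 <= D by exact: le_trans (hD j).
  apply: le_trans (_ : K * e * D <= _); last by rewrite -!mulrA ler_wpM2r ?mulr_ge0// ler_norm.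
  have := FA _ _ _ _ ed he he' hD j; rewrite mulmxBl !mxE.
  by congr (`|_| <= _); ring.
have d_ge0 : 0 <= d by exact: ltW.
pose cl (h : 'rV[R]_m.+1) : 'rV[R]_m.+1 := \row_j clip d (h 0 j).
have cl_le h j : `|cl h 0 j| <= d by rewrite mxE clip_le.
have cl_abs h j : `|cl h 0 j| <= `|h 0 j| by rewrite mxE clip_le_norm.
have cl_lip (h h' : 'rV[R]_m.+1) (D : R) : (forall j, `|h 0 j - h' 0 j| <= D) ->
    forall j, `|cl h 0 j - cl h' 0 j| <= D.
  by move=> hD j; apply: le_trans (hD j); rewrite !mxE clip_lipschitz.
have cl_id (h : 'rV[R]_m.+1) : (forall j, `|h 0 j| <= d) -> cl h = h.
  move=> hd; apply/rowP => j; rewrite mxE; have := hd j; rewrite ler_norml => /andP[h1 h2].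
  by rewrite /clip min_r// max_r.
have N0 : N 0 = 0 by rewrite /N addr0 mul0mx subr0.
pose xl t := expR (a * t) *: (cos (w * t) *: p - sin (w * t) *: q).
have dxl (t : R) j : is_derive t 1 (fun u => xl u 0 j) ((xl t *m A) 0 j).
  rewrite /xl; under eq_fun do rewrite !mxE.
  rewrite -scalemxAl mulmxBl -!scalemxAl pA qA; apply: is_derive_eq.
  by rewrite /GRing.scale/= !mxE; ring.
pose c : R := \sum_j (`|p 0 j| + `|q 0 j|).
have c0 : 0 <= c by apply: sumr_ge0 => j _; rewrite addr_ge0.
have xlc t j : `|xl t 0 j| <= c * expR (a * t).
  rewrite !mxE normrM ger0_norm ?expR_ge0// mulrC ler_wpM2r ?expR_ge0//.
  apply: le_trans (ler_normB _ _) _; rewrite !normrM.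
  apply: le_trans (_ : `|p 0 j| + `|q 0 j| <= _); last first.
    by rewrite /c (bigD1 j)//= lerDl; apply: sumr_ge0 => k _; rewrite addr_ge0.
  by rewrite lerD// ler_piMl// ler_norml ?cos_geN1 ?cos_le1 ?sin_geN1 ?sin_le1.
have expa t : expR (2 * a * t) = expR (a * t) ^+ 2.
  by rewrite -expRM_natl; congr expR; ring.
have KM0 : 0 <= K' * c ^+ 2 by rewrite mulr_ge0// exprn_ge0.
have Kd0 : 0 <= K' * d by rewrite mulr_ge0// ltW.
have b0 : 0 <= 2 * a by rewrite mulr_ge0// ltW.
have NL (h h' : 'rV[R]_m.+1) (D : R) : (forall j, `|h 0 j - h' 0 j| <= D) ->
    forall j, `|(N \o cl) h 0 j - (N \o cl) h' 0 j| <= K' * d * D.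
  by move=> hD j; apply: NP => //; exact: cl_lip.
have cxl j : continuous (fun t => xl t 0 j) by move=> t; exact: is_derive_continuous (dxl t j).
have Nxl t j : `|(N \o cl) (xl t) 0 j| <= K' * c ^+ 2 * expR (2 * a * t).
  rewrite expa /= (_ : K' * _ * _ = K' * (c * expR (a * t)) * (c * expR (a * t))); last by ring.
  have E0 : 0 <= c * expR (a * t) by rewrite mulr_ge0// expR_ge0.
  (* The radius is the minimum because it must stay below [d0] for all t and also shrink like exp(a
     t) to give a quadratic bound. *)
  have := NP (cl (xl t)) 0 (Num.min d (c * expR (a * t))) (c * expR (a * t)).
  rewrite N0 => h; apply: le_trans (_ : _ <= K' * Num.min d (c * expR (a * t)) * (c * expR (a * t))) _.
    have -> : N (cl (xl t)) 0 j = N (cl (xl t)) 0 j - (0 : 'rV[R]_m.+1) 0 j by rewrite [X in _ - X]mxE subr0.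
    apply: h.
  - by rewrite ge_min dd0.
  - by move=> i; rewrite le_min cl_le (le_trans (cl_abs _ _)).
  - by move=> i; rewrite mxE normr0 le_min ltW.
  - by move=> i; rewrite [X in _ - X]mxE subr0 (le_trans (cl_abs _ _)).
  - by rewrite ler_wpM2r// ler_wpM2l// ge_min lexx orbT.
have [h [dh hb]] := exists_fixed_curve SP b0 S0 Kd0 SKd KM0 NL cxl Nxl.
pose C := 2 * (S * (K' * c ^+ 2)).
have C0 : 0 <= C by rewrite !mulr_ge0// exprn_ge0.
have hb' t j : `|h t 0 j| <= C * expR (a * t) ^+ 2 by rewrite -expa.
have small (e : R) : 0 < e -> exists T, forall t, t < T -> forall j, `|(xl t + h t) 0 j| <= e.
  move=> e0; have [||T TP] := @exists_expR_small a (Num.min 1 (e / (c + C + 1))) => //.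
    by rewrite lt_min ltr01/= divr_gt0//; lra.
  exists T => t /ltW/TP; rewrite le_min ler_pdivlMr; last by lra.
  move=> /andP[E1 E2] j; rewrite mxE; apply: le_trans (ler_normD _ _) _.
  apply: le_trans (lerD (xlc t j) (hb' t j)) _.
  apply: le_trans E2; have E0 := expR_ge0 (a * t).
  have : C * expR (a * t) ^+ 2 <= C * expR (a * t) by rewrite ler_wpM2l// expr2 ler_piMl.
  by lra.
have [T TP] := small _ d_gt0.
exists (fun t => x0 + (xl t + h t)), T; split.
- move=> t tT j; under eq_fun do rewrite mxE; under eq_fun do rewrite [X in _ + X]mxE.
  apply: is_derive_eq (is_deriveD (is_derive_cst _ _ _) (is_deriveD (dxl t j) (dh t j))) _.
  rewrite add0r /= cl_id; last exact: TP.
  rewrite /N mulmxDl !mxE; ring.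
- move=> e /small[T' T'P]; exists T' => t tT' j.
  rewrite mxE (_ : _ - _ = (xl t + h t) 0 j); [exact: T'P|by ring].
- move=> T'.
  have [j pj] : exists j, p 0 j != 0.
    by apply/existsP; apply: contraNT pn0; rewrite negb_exists => /forallP/= pz;
       apply/eqP/rowP => j; rewrite mxE; apply/eqP; rewrite -[_ == _]negbK.
  have pj0 : 0 < `|p 0 j| by rewrite normr_gt0.
  (* At a full period, x t = x0 would force |p_j| exp(a t) <= C exp(2 a t), which fails once (C + 1)
     exp(a t) <= |p_j|. *)
  have [||T1 T1P] := @exists_expR_small a (`|p 0 j| / (C + 1)) => //.
    by rewrite divr_gt0//; lra.
  have [t [tT ct st]] := exists_full_period w (Num.min T' T1).
  exists t; first by move: tT; rewrite lt_min => /andP[].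
  apply/negP => /eqP/(congr1 (fun y : 'rV_m.+1 => y 0 j)).
  rewrite mxE -[RHS]addr0 => /addrI; rewrite mxE => /eqP; rewrite addr_eq0 => /eqP xh.
  have := hb' t j; rewrite -normrN -xh !mxE ct st mul1r mul0r subr0 normrM ger0_norm ?expR_ge0//.
  rewrite expr2 mulrA mulrC ler_pM2r ?expR_gt0// leNgt => /negP; apply.
  have /T1P : t <= T1 by move: tT; rewrite lt_min => /andP[_ /ltW].
  rewrite ler_pdivlMr; last by lra.
  have := expR_gt0 (a * t); lra.
Qed.

End UnstableCurve.

(** * Linearization with quadratic remainder *)

Section QuadraticRemainder.
Context {R : realType} {m : nat}.
Implicit Types (x h : 'rV[R]_m) (f g : 'rV[R]_m -> R) (G : 'cV[R]_m).

Definition vle h (d : R) := forall j, `|h 0 j| <= d.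

(* On the ball of radius d around x, the remainder of the linearization of f has
   Lipschitz constant K d. *)
Definition remainder_le x f G (K d0 : R) := forall h h' (d D : R), d <= d0 ->
  vle h d -> vle h' d -> vle (h - h') D ->
  `|f (x + h) - f (x + h') - ((h - h') *m G) 0 0| <= K * d * D.

(** A full linearization is asserted, but only one entry of the gradient is exposed: the trace needs
    nothing beyond the diagonal of the Jacobian. *)
Definition has_partial x f (i : 'I_m) (a : R) := exists G (K d0 : R),
  [/\ 0 <= K, 0 < d0, remainder_le x f G K d0 & G i 0 = a].

Lemma vle_ge0 h d : 'I_m -> vle h d -> 0 <= d.
Proof. by move=> i hd; exact: le_trans (hd i). Qed.

Lemma has_partial_eq x f i a b : has_partial x f i a -> a = b -> has_partial x f i b.
Proof. by move=> ? <-. Qed.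

Lemma has_partial_ext x f g i a : f =1 g -> has_partial x f i a -> has_partial x g i a.
Proof. by move=> /funext ->. Qed.

Lemma has_partial_cst x i (c : R) : has_partial x (fun=> c) i 0.
Proof.
exists 0, 0, 1; split=> //; last by rewrite mxE.
by move=> h h' d D _ _ _ _; rewrite mulmx0 mxE !subrr normr0 !mul0r.
Qed.

Lemma has_partial_coord x i j : has_partial x (fun x => x 0 j) i (i == j)%:R.
Proof.
exists (delta_mx j 0), 0, 1; split=> //; last by rewrite mxE eqxx andbT.
move=> h h' d D _ _ _ _; rewrite !mul0r [X in _ - X]mxE (bigD1 j)//= big1 => [|k kj].
  by rewrite !mxE !eqxx/= [X in `|X|](_ : _ = 0) ?normr0//; ring.
by rewrite [X in _ * X]mxE (negbTE kj) mulr0.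
Qed.

Lemma has_partialD x f g i a b : has_partial x f i a -> has_partial x g i b ->
  has_partial x (fun x => f x + g x) i (a + b).
Proof.
move=> [G1 [K1 [d1 [K10 d10 r1 <-]]]] [G2 [K2 [d2 [K20 d20 r2 <-]]]].
exists (G1 + G2), (K1 + K2), (Num.min d1 d2); split.
- exact: addr_ge0.
- by rewrite lt_min d10.
- move=> h h' d D; rewrite le_min => /andP[dd1 dd2] hd hd' hD.
  rewrite mulmxDr [X in _ - X]mxE !mulrDl.
  apply: le_trans (lerD (r1 _ _ _ _ dd1 hd hd' hD) (r2 _ _ _ _ dd2 hd hd' hD)).
  by apply: le_trans (ler_normD _ _); rewrite le_eqVlt; apply/orP; left; apply/eqP; congr `|_|; ring.
- by rewrite mxE.
Qed.

Lemma remainder_le_lipschitz x f G K d0 : 0 <= K -> 0 < d0 -> 'I_m ->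
  remainder_le x f G K d0 -> exists2 C, 0 <= C & forall h h' D,
  vle h d0 -> vle h' d0 -> vle (h - h') D -> `|f (x + h) - f (x + h')| <= C * D.
Proof.
move=> K0 d00 i r; exists (K * d0 + \sum_j `|G j 0|).
  by rewrite addr_ge0 ?sumr_ge0// mulr_ge0// ltW.
move=> h h' D hd hd' hD; have := r _ _ _ _ (lexx d0) hd hd' hD.
set l := ((h - h') *m G) 0 0 => h1.
have h2 : `|l| <= (\sum_j `|G j 0|) * D.
  rewrite /l mxE mulr_suml; apply: le_trans (ler_norm_sum _ _ _) _.
  by apply: ler_sum => j _; rewrite normrM mulrC ler_wpM2l// hD.
rewrite mulrDl -[X in `|X|](subrK l); apply: le_trans (ler_normD _ _) _.
exact: lerD.
Qed.

Lemma has_partialM x f g i a b : has_partial x f i a -> has_partial x g i b ->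
  has_partial x (fun x => f x * g x) i (f x * b + g x * a).
Proof.
move=> [G1 [K1 [d1 [K10 d10 r1 <-]]]] [G2 [K2 [d2 [K20 d20 r2 <-]]]].
have [C1 C10 l1] := remainder_le_lipschitz K10 d10 i r1.
have [C2 C20 l2] := remainder_le_lipschitz K20 d20 i r2.
exists (f x *: G2 + g x *: G1), (`|f x| * K2 + `|g x| * K1 + C1 * C2 + C2 * C1), (Num.min d1 d2); split.
- by rewrite !addr_ge0// mulr_ge0.
- by rewrite lt_min d10.
- move=> h h' d D; rewrite le_min => /andP[dd1 dd2] hd hd' hD.
  have d0 : 0 <= d := vle_ge0 i hd.
  have D0 : 0 <= D := vle_ge0 i hD.
  have w e h1 : d <= e -> vle h1 d -> vle h1 e by move=> de h1d j; exact: le_trans de.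
  have z e : 0 < e -> vle 0 e by move=> /ltW e0 j; rewrite mxE normr0.
  have p1 : `|f (x + h) - f x| <= C1 * d.
    rewrite -{2}[x]addr0; apply: l1; [exact: w hd|exact: z|by rewrite subr0].
  have p2 : `|g (x + h') - g x| <= C2 * d.
    rewrite -{2}[x]addr0; apply: l2; [exact: w hd'|exact: z|by rewrite subr0].
  have q1 := l1 _ _ _ (w _ _ dd1 hd) (w _ _ dd1 hd') hD.
  have q2 := l2 _ _ _ (w _ _ dd2 hd) (w _ _ dd2 hd') hD.
  have s1 := r1 _ _ _ _ dd1 hd hd' hD.
  have s2 := r2 _ _ _ _ dd2 hd hd' hD.
  have -> : ((h - h') *m (f x *: G2 + g x *: G1)) 0 0 =
      f x * ((h - h') *m G2) 0 0 + g x * ((h - h') *m G1) 0 0.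
    by rewrite mulmxDr -!scalemxAr !mxE.
  move: s1 s2 q1 q2 p1 p2; set u1 := ((h - h') *m G1) 0 0; set u2 := ((h - h') *m G2) 0 0.
  move=> s1 s2 q1 q2 p1 p2.
  (* The last two terms are each an increment from x, of order d, times a difference, of order D. *)
  rewrite (_ : _ - _ = f x * (g (x + h) - g (x + h') - u2) + g x * (f (x + h) - f (x + h') - u1)
    + (f (x + h) - f x) * (g (x + h) - g (x + h')) + (g (x + h') - g x) * (f (x + h) - f (x + h')));
    last by ring.
  rewrite [leRHS](_ : _ = `|f x| * K2 * d * D + `|g x| * K1 * d * D + C1 * C2 * d * D +
    C2 * C1 * d * D); last by ring.
  apply: le_trans (ler_normD _ _) _; apply: lerD; last first.
    rewrite normrM (_ : C2 * C1 * d * D = (C2 * d) * (C1 * D)); last by ring.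
    by rewrite ler_pM.
  apply: le_trans (ler_normD _ _) _; apply: lerD; last first.
    rewrite normrM (_ : C1 * C2 * d * D = (C1 * d) * (C2 * D)); last by ring.
    by rewrite ler_pM.
  apply: le_trans (ler_normD _ _) _; apply: lerD; rewrite normrM.
  - by rewrite -!mulrA ler_wpM2l// mulrA.
  - by rewrite -!mulrA ler_wpM2l// mulrA.
- by rewrite !mxE.
Qed.

Definition scalar_remainder (phi : R -> R) (y a : R) := exists K d0 : R,
  [/\ 0 <= K, 0 < d0 & forall u u' d, d <= d0 -> `|u| <= d -> `|u'| <= d ->
   `|phi (y + u) - phi (y + u') - a * (u - u')| <= K * d * `|u - u'|].

Lemma has_partial_comp x f i a (phi : R -> R) b :
  scalar_remainder phi (f x) b -> has_partial x f i a ->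
  has_partial x (fun x => phi (f x)) i (b * a).
Proof.
move=> [K2 [d2 [K20 d20 r2]]] [G1 [K1 [d1 [K10 d10 r1 <-]]]].
have [C C0 l1] := remainder_le_lipschitz K10 d10 i r1.
(* The radius d2 / (C + 1) keeps the increments of f, at most C d, within the range where phi is
   controlled. *)
exists (b *: G1), (K2 * C * C + `|b| * K1), (Num.min d1 (d2 / (C + 1))); split.
- by rewrite !addr_ge0// !mulr_ge0.
- by rewrite lt_min d10 divr_gt0// ltr_wpDl.
- move=> h h' d D; rewrite le_min => /andP[dd1 dd2] hd hd' hD.
  have d0 : 0 <= d := vle_ge0 i hd.
  have D0 : 0 <= D := vle_ge0 i hD.
  have w e h1 : d <= e -> vle h1 d -> vle h1 e by move=> de h1d j; exact: le_trans de.
  have z e : 0 < e -> vle 0 e by move=> /ltW e0 j; rewrite mxE normr0.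
  have p h1 : vle h1 d -> `|f (x + h1) - f x| <= C * d.
    by move=> h1d; rewrite -{2}[x]addr0; apply: l1; [exact: w h1d|exact: z|rewrite subr0].
  have q1 := l1 _ _ _ (w _ _ dd1 hd) (w _ _ dd1 hd') hD.
  have s1 := r1 _ _ _ _ dd1 hd hd' hD.
  have Cd : C * d <= d2.
    move: dd2; rewrite ler_pdivlMr ?ltr_wpDl// => dd2; apply: le_trans dd2.
    by rewrite mulrDr mulr1 mulrC lerDl.
  have := r2 _ _ _ Cd (p _ hd) (p _ hd').
  rewrite ![f x + _]addrC !subrK.
  have -> : ((h - h') *m (b *: G1)) 0 0 = b * ((h - h') *m G1) 0 0.
    by rewrite -scalemxAr !mxE.
  move: s1; set u1 := ((h - h') *m G1) 0 0 => s1.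
  rewrite (_ : f (x + h) - f x - _ = f (x + h) - f (x + h')); last by ring.
  set df := f (x + h) - f (x + h') in q1 s1 * => s2.
  rewrite (_ : _ - _ = (phi (f (x + h)) - phi (f (x + h')) - b * df) + b * (df - u1)); last by ring.
  apply: le_trans (ler_normD _ _) _.
  rewrite [leRHS](_ : _ = K2 * C * C * d * D + `|b| * K1 * d * D); last by ring.
  apply: lerD.
    apply: le_trans s2 _; rewrite (_ : K2 * C * C * d * D = K2 * (C * d) * (C * D)); last by ring.
    by rewrite ler_wpM2l// mulr_ge0// mulr_ge0.
  by rewrite normrM -!mulrA ler_wpM2l// mulrA.
- by rewrite mxE.
Qed.

Lemma scalar_remainder_MVT (phi dphi : R -> R) (y : R) :
  (forall t : R, is_derive t 1 phi (dphi t)) ->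
  (forall t, `|dphi t - dphi y| <= `|t - y|) -> scalar_remainder phi y (dphi y).
Proof.
move=> d l; exists 1, 1; split=> // u u' e _ ue ue'.
suff H u1 u2 : `|u1| <= e -> `|u2| <= e -> u1 <= u2 ->
    `|phi (y + u2) - phi (y + u1) - dphi y * (u2 - u1)| <= 1 * e * `|u2 - u1|.
  have [uu|/ltW uu] := leP u' u; first exact: H.
  rewrite (distrC u) (_ : _ - _ - _ = - (phi (y + u') - phi (y + u) - dphi y * (u' - u))).
    by rewrite normrN; exact: H.
  by ring.
move=> h1 h2 h12.
have y12 : y + u1 <= y + u2 by rewrite lerD2l.
have [|c cI ->] := MVT_segment y12 (fun t _ => d t); first exact: is_derive_within d.
rewrite (_ : _ - _ = (dphi c - dphi y) * (u2 - u1)); last by ring.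
rewrite normrM mul1r ler_wpM2r//; apply: le_trans (l c) _.
move: cI h1 h2; rewrite in_itv /= => /andP[c1 c2].
by rewrite !ler_norml; lra.
Qed.

Lemma cos_lipschitz (s t : R) : `|cos s - cos t| <= `|s - t|.
Proof.
wlog ts : s t / t <= s.
  by move=> H; have [/H//|/ltW/H] := leP t s; rewrite distrC (distrC t).
have [|c _ ->] := MVT_segment ts (fun t _ => is_derive_cos t).
  by apply: continuous_subspaceT; exact: continuous_cos.
by rewrite normrM normrN ler_piMl// ler_norml sin_geN1 sin_le1.
Qed.

Lemma sin_lipschitz (s t : R) : `|sin s - sin t| <= `|s - t|.
Proof.
wlog ts : s t / t <= s.
  by move=> H; have [/H//|/ltW/H] := leP t s; rewrite distrC (distrC t).
have [|c _ ->] := MVT_segment ts (fun t _ => is_derive_sin t).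
  by apply: continuous_subspaceT; exact: continuous_sin.
by rewrite normrM ler_piMl// ler_norml cos_geN1 cos_le1.
Qed.

Lemma has_partial_cos x f i a : has_partial x f i a ->
  has_partial x (fun x => cos (f x)) i (- sin (f x) * a).
Proof.
apply: has_partial_comp; apply: (@scalar_remainder_MVT _ (fun t => - sin t)) => t.
by rewrite -opprD normrN sin_lipschitz.
Qed.

Lemma has_partial_sin x f i a : has_partial x f i a ->
  has_partial x (fun x => sin (f x)) i (cos (f x) * a).
Proof.
by apply: has_partial_comp; apply: scalar_remainder_MVT => t; exact: cos_lipschitz.
Qed.

Lemma has_partialV x f i a : f x != 0 -> has_partial x f i a ->
  has_partial x (fun x => (f x)^-1) i (- (f x) ^- 2 * a).
Proof.
move=> fx0; apply: has_partial_comp; set y := f x in fx0 *.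
have y0 : 0 < `|y| by rewrite normr_gt0.
(* Within |y| / 2 both y + u and y + u' stay at least |y| / 2 away from 0. The numerator below is at
   most 3 |y| d and the denominator at least |y|^4 / 4, whence 12 / |y|^3. *)
exists (12 / `|y| ^+ 3), (`|y| / 2); split.
- by rewrite divr_ge0// exprn_ge0.
- by rewrite divr_gt0.
move=> u u' d dy ud ud'.
have lb s : `|s| <= d -> `|y| / 2 <= `|y + s|.
  move=> sd; have := ler_normB (y + s) s; rewrite addrK; lra.
have nz s : `|s| <= d -> y + s != 0.
  by move=> /lb h; rewrite -normr_gt0; lra.
have nu := nz _ ud; have nu' := nz _ ud'.
rewrite (_ : _ - _ = (u - u') * ((y * (u + u') + u * u') / (y ^+ 2 * (y + u) * (y + u')))); last first.
  by field; rewrite fx0 nu nu'.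
have d0 : 0 <= d by exact: le_trans ud.
rewrite (normrM (u - u')) mulrC ler_wpM2r// normrM normfV.
rewrite (normrM _ (y + u')) (normrM _ (y + u)) normrX.
have num : `|y * (u + u') + u * u'| <= 3 * `|y| * d.
  apply: le_trans (ler_normD _ _) _; rewrite !normrM.
  have h1 : `|y| * `|u + u'| <= `|y| * (d + d).
    by rewrite ler_wpM2l// (le_trans (ler_normD _ _))// lerD.
  have h2 : `|u| * `|u'| <= d * `|y|.
    by rewrite ler_pM// (le_trans ud')//; lra.
  lra.
have den : `|y| ^+ 2 * (`|y| / 2 * (`|y| / 2)) <= `|y| ^+ 2 * `|y + u| * `|y + u'|.
  rewrite -(mulrA _ `|y + u|) ler_wpM2l ?exprn_ge0//.
  by apply: ler_pM; rewrite ?divr_ge0//; exact: lb.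
have den0 : 0 < `|y| ^+ 2 * (`|y| / 2 * (`|y| / 2)).
  by rewrite mulr_gt0 ?exprn_gt0// mulr_gt0 ?divr_gt0.
apply: le_trans (_ : 3 * `|y| * d / (`|y| ^+ 2 * (`|y| / 2 * (`|y| / 2))) <= _).
  rewrite ler_pM ?invr_ge0 ?mulr_ge0 ?exprn_ge0//.
  by rewrite lef_pV2 ?posrE// (lt_le_trans den0).
by rewrite le_eqVlt; apply/orP; left; apply/eqP; field; rewrite lt0r_neq0.
Qed.

Lemma has_partialZ x f l (c a : R) :
  has_partial x f l a -> has_partial x (fun x => c * f x) l (c * a).
Proof.
move=> h; apply: has_partial_eq (has_partialM (has_partial_cst x l c) h) _.
by rewrite mulr0 addr0.
Qed.

Lemma has_partialB x f g l (a b : R) :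
  has_partial x f l a -> has_partial x g l b ->
  has_partial x (fun x => f x - g x) l (a - b).
Proof.
move=> hf hg; apply: has_partial_eq (has_partial_ext _ (has_partialD hf (has_partialZ (-1) hg))) _.
  by move=> y; rewrite mulN1r.
by rewrite mulN1r.
Qed.

Lemma has_partial_sum (J : finType) (P : pred J) x (f : J -> 'rV[R]_m -> R) i (a : J -> R) :
  (forall j, P j -> has_partial x (f j) i (a j)) ->
  has_partial x (fun x => \sum_(j | P j) f j x) i (\sum_(j | P j) a j).
Proof.
move=> H.
rewrite -big_filter; apply: (@has_partial_ext _ (fun x => \sum_(j <- [seq j <- index_enum J | P j]) f j x)).
  by move=> y; rewrite big_filter.
have : all P [seq j <- index_enum J | P j] by exact: filter_all.
elim: [seq _ <- _ | _] => [_|j s ih /= /andP[Pj Ps]].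
  rewrite big_nil; apply: has_partial_ext (has_partial_cst x i 0).
  by move=> y; rewrite big_nil.
rewrite big_cons; apply: has_partial_ext (has_partialD (H j Pj) (ih Ps)).
by move=> y; rewrite big_cons.
Qed.

End QuadraticRemainder.

Lemma exists_jacobian {R : realType} {m : nat} (x : 'rV[R]_m) (F : 'rV[R]_m -> 'rV[R]_m)
    (a : 'I_m -> R) :
  (forall i, has_partial x (fun y => F y 0 i) i (a i)) ->
  exists (A : 'M[R]_m) (K d0 : R),
  [/\ 0 < d0, \tr A = \sum_i a i &
   forall (h h' : 'rV[R]_m) (d D : R), d <= d0 ->
    (forall j, `|h 0 j| <= d) -> (forall j, `|h' 0 j| <= d) ->
    (forall j, `|h 0 j - h' 0 j| <= D) ->
    forall j, `|F (x + h) 0 j - F (x + h') 0 j - ((h - h') *m A) 0 j| <= K * d * D].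
Proof.
move=> H; have [G GP] := choice H; have [K KP] := choice GP; have [d0 dP] := choice KP.
have dsum0 : 0 <= \sum_i (d0 i)^-1.
  by apply: sumr_ge0 => i _; rewrite invr_ge0 ltW//; have [] := dP i.
(* The last witness is a positive number below every [d0 i], valid for an empty index set too. *)
exists (\matrix_(i, j) G j i 0), (\sum_i K i), (1 + \sum_i (d0 i)^-1)^-1; split.
- by rewrite invr_gt0 ltr_pwDl.
- by apply: eq_bigr => i _; rewrite mxE; have [] := dP i.
move=> h h' d D dd hd hd' hD j; have [K0 dj0 r _] := dP j.
have d_ge0 : 0 <= d by exact: le_trans (hd j).
have D_ge0 : 0 <= D by exact: le_trans (hD j).
have ddj : d <= d0 j.
  apply: le_trans dd _; rewrite -[leRHS]invrK lef_pV2 ?posrE ?invr_gt0// ?ltr_pwDl//.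
  rewrite (bigD1 j)//= addrCA lerDl addr_ge0// sumr_ge0// => i _.
  by rewrite invr_ge0 ltW//; have [] := dP i.
have hD' : vle (h - h') D by move=> i; rewrite !mxE.
apply: le_trans (_ : K j * d * D <= _); last first.
  rewrite -!mulrA ler_wpM2r ?mulr_ge0// (bigD1 j)//= lerDl sumr_ge0// => i _.
  by have [] := dP i.
apply: le_trans (r _ _ _ _ ddj hd hd' hD').
by rewrite !mxE le_eqVlt; apply/orP; left; apply/eqP; congr (`|_ - _|); apply: eq_bigr => i _; rewrite !mxE.
Qed.

(** * The unicycles in a turning frame *)

Section Model.
Context {R : realType} {n : nat}.
Implicit Types (x : 'rV[R]_(n + n + n)) (p : 'I_n -> R) (i j : 'I_n).
Variables (v k : R) (e : rel 'I_n).

Definition posx x i := x 0 (lshift n (lshift n i)).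
Definition posy x i := x 0 (lshift n (rshift n i)).
Definition heading x i := x 0 (rshift (n + n) i).
Definition node (a b c : 'I_n -> R) : 'rV[R]_(n + n + n) :=
  row_mx (row_mx (\row_i a i) (\row_i b i)) (\row_i c i).

Lemma posx_node a b c i : posx (node a b c) i = a i.
Proof. by rewrite /posx /node !row_mxEl mxE. Qed.
Lemma posy_node a b c i : posy (node a b c) i = b i.
Proof. by rewrite /posy /node row_mxEl row_mxEr mxE. Qed.
Lemma heading_node a b c i : heading (node a b c) i = c i.
Proof. by rewrite /heading /node row_mxEr mxE. Qed.

Definition relx x i j := posx x j - posx x i.
Definition rely x i j := posy x j - posy x i.
Definition dist2 x i j := relx x i j ^+ 2 + rely x i j ^+ 2.

(* [ahead] is rho_ij cos alpha_ij and [aside] is rho_ij sin alpha_ij. *)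
Definition ahead x i j := relx x i j * cos (heading x i) + rely x i j * sin (heading x i).
Definition aside x i j := rely x i j * cos (heading x i) - relx x i j * sin (heading x i).

(** The control law in Cartesian form: sin(alpha) / rho is [aside / dist2], and likewise for the
    cosine, so neither square roots nor arguments of vectors have to be differentiated. *)
Definition turn x i : R := #|[set j | e i j]%SET|%:R^-1 *
  \sum_(j | e i j) (2 * v * (aside x i j * (dist2 x i j)^-1)
    + k * ((ahead x i j + ahead x j i) * (dist2 x i j)^-1)).

(* The plane turns at the angular speed v / k of the circular formation of
   signed radius k, which is therefore at rest. *)
Definition field x := node
  (fun i => v * cos (heading x i) + v / k * posy x i)
  (fun i => v * sin (heading x i) - v / k * posx x i)
  (fun i => turn x i - v / k).

(** The phase [p i] is the heading, tangent to the circle; the position is k times the unit vector a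
    quarter turn behind it, so motion is counterclockwise exactly when k > 0. *)
Definition circle p := node (fun i => k * sin (p i)) (fun i => - k * cos (p i)) p.

Lemma relx_circle p i j : relx (circle p) i j = k * (sin (p j) - sin (p i)).
Proof. by rewrite /relx !posx_node mulrBr. Qed.
Lemma rely_circle p i j : rely (circle p) i j = - k * (cos (p j) - cos (p i)).
Proof. by rewrite /rely !posy_node mulrBr. Qed.

Lemma dist2_circle p i j : dist2 (circle p) i j = 2 * k ^+ 2 * (1 - cos (p j - p i)).
Proof.
rewrite /dist2 relx_circle rely_circle cosB.
have ci := cos2sin2 (p i); have cj := cos2sin2 (p j).
rewrite [LHS](_ : _ = k ^+ 2 * ((cos (p j) ^+ 2 + sin (p j) ^+ 2) +
  (cos (p i) ^+ 2 + sin (p i) ^+ 2) - 2 * (cos (p j) * cos (p i) + sin (p j) * sin (p i)))); last by ring.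
by rewrite ci cj; ring.
Qed.

Lemma aside_circle p i j : aside (circle p) i j = k * (1 - cos (p j - p i)).
Proof.
rewrite /aside relx_circle rely_circle heading_node cosB.
have ci := cos2sin2 (p i).
rewrite [LHS](_ : _ = k * (cos (p i) ^+ 2 + sin (p i) ^+ 2 -
   (cos (p j) * cos (p i) + sin (p j) * sin (p i)))); last by ring.
by rewrite ci; ring.
Qed.

Lemma ahead_circle p i j : ahead (circle p) i j = k * sin (p j - p i).
Proof. by rewrite /ahead relx_circle rely_circle heading_node sinB; ring. Qed.

Lemma mean_cst i (c : R) : (exists j, e i j) ->
  #|[set j | e i j]%SET|%:R^-1 * \sum_(j | e i j) c = c.
Proof.
move=> [j ij]; have -> : #|[set j | e i j]%SET| = #|e i| by apply: eq_card => j'; rewrite inE.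
rewrite sumr_const -[c *+ _]mulr_natr mulrCA mulVf ?mulr1//.
by rewrite pnatr_eq0 -lt0n; apply/card_gt0P; exists j.
Qed.

Section Equilibrium.
Variable p : 'I_n -> R.
Hypothesis k_neq0 : k != 0.
Hypothesis e_irr : irreflexive e.
Hypothesis e_nbr : forall i, exists j, e i j.
Hypothesis p_sep : forall i j, i != j -> cos (p j - p i) != 1.

Lemma edge_neq i j : e i j -> i != j.
Proof. by apply: contraTneq => ->; rewrite e_irr. Qed.

Lemma dist2_circle_neq0 i j : i != j -> dist2 (circle p) i j != 0.
Proof.
move=> ij; rewrite dist2_circle !mulf_neq0 ?expf_neq0//.
by rewrite subr_eq0 eq_sym p_sep.
Qed.

(** For every pair [aside / dist2] is 1 / (2 k) and [ahead] is antisymmetric, so each neighbor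
    contributes v / k to the mean. *)
Lemma turn_circle i : turn (circle p) i = v / k.
Proof.
rewrite /turn -[RHS](mean_cst _ (e_nbr i)); congr (_ * _); apply: eq_bigr => j ij.
have d0 := dist2_circle_neq0 (edge_neq ij); move: d0; rewrite dist2_circle => d0.
rewrite aside_circle !ahead_circle -[p i - p j]opprB sinN.
have c0 : 1 - cos (p j - p i) != 0 by rewrite subr_eq0 eq_sym p_sep// edge_neq.
by field; rewrite c0 k_neq0.
Qed.

Lemma field_circle : field (circle p) = 0.
Proof.
rewrite /field /node; apply/rowP => l; rewrite [RHS]mxE.
case: (split_ordP l) => [l' ->|i ->]; last first.
  by rewrite row_mxEr mxE turn_circle subrr.
case: (split_ordP l') => [i ->|i ->]; rewrite row_mxEl ?row_mxEl ?row_mxEr mxE heading_node.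
  by rewrite posy_node; field.
by rewrite posx_node; field.
Qed.

(** Up to the factor k, the mean over the neighbors of cos(alpha_ij) / rho_ij. *)
Definition slope i : R := #|[set j | e i j]%SET|%:R^-1 *
  \sum_(j | e i j) (sin (p j - p i) / dist2 (circle p) i j).

Lemma has_partial_posx x l i : has_partial x (fun x => posx x i) l (l == lshift n (lshift n i))%:R.
Proof. exact: has_partial_coord. Qed.
Lemma has_partial_posy x l i : has_partial x (fun x => posy x i) l (l == lshift n (rshift n i))%:R.
Proof. exact: has_partial_coord. Qed.
Lemma has_partial_heading x l i : has_partial x (fun x => heading x i) l (l == rshift (n + n) i)%:R.
Proof. exact: has_partial_coord. Qed.

(** The heading of i enters only [ahead x i j], with derivative [aside], and [aside x i j], with
    derivative [- ahead]. The constant 1 / 2 is k * aside / dist2 on the circle of signed radius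
    k. *)
Lemma has_partial_turn i : has_partial (circle p) (fun x => turn x i - v / k)
  (rshift (n + n) i) (1 / 2 - 2 * v * k * slope i).
Proof.
set l := rshift (n + n) i; set x := circle p.
have hx j : has_partial x (fun x => posx x j) l 0.
  apply: has_partial_eq (has_partial_posx x l j) _.
  by rewrite /l eq_sym eq_lrshift.
have hy j : has_partial x (fun x => posy x j) l 0.
  apply: has_partial_eq (has_partial_posy x l j) _.
  by rewrite /l eq_sym eq_lrshift.
have hh j : has_partial x (fun x => heading x j) l (i == j)%:R.
  apply: has_partial_eq (has_partial_heading x l j) _.
  by rewrite /l (inj_eq (@rshift_inj _ _)).
have hrx a b : has_partial x (fun x => relx x a b) l 0.
  by apply: has_partial_eq (has_partialB (hx b) (hx a)) _; rewrite subr0.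
have hry a b : has_partial x (fun x => rely x a b) l 0.
  by apply: has_partial_eq (has_partialB (hy b) (hy a)) _; rewrite subr0.
have hahead a b : has_partial x (fun x => ahead x a b) l (aside x a b * (i == a)%:R).
  apply: has_partial_eq (has_partialD (has_partialM (hrx a b) (has_partial_cos (hh a)))
    (has_partialM (hry a b) (has_partial_sin (hh a)))) _.
  by rewrite /aside; ring.
have haside a b : has_partial x (fun x => aside x a b) l (- ahead x a b * (i == a)%:R).
  apply: has_partial_eq (has_partialB (has_partialM (hry a b) (has_partial_cos (hh a)))
    (has_partialM (hrx a b) (has_partial_sin (hh a)))) _.
  by rewrite /ahead; ring.
have hd a b : a != b -> has_partial x (fun x => (dist2 x a b)^-1) l 0.
  move=> ab; have hd2 : has_partial x (fun x => dist2 x a b) l 0.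
    apply: has_partial_eq (has_partialD (has_partialM (hrx a b) (hrx a b))
      (has_partialM (hry a b) (hry a b))) _.
    by ring.
  apply: has_partial_eq (has_partialV (dist2_circle_neq0 ab) hd2) _.
  by rewrite mulr0.
have -> : 1 / 2 - 2 * v * k * slope i = #|[set j | e i j]%SET|%:R^-1 *
    \sum_(j | e i j) (1 / 2 - 2 * v * k * (sin (p j - p i) / dist2 x i j)) - 0.
  by rewrite subr0 sumrB mulrBr (mean_cst _ (e_nbr i)) -mulr_sumr mulrCA.
apply: has_partialB; last exact: has_partial_cst.
apply: has_partialZ; apply: has_partial_sum => j ij.
have ineqj := edge_neq ij.
apply: has_partial_eq (has_partialD
  (has_partialZ (2 * v) (has_partialM (haside i j) (hd _ _ ineqj)))
  (has_partialZ k (has_partialM (has_partialD (hahead i j) (hahead j i)) (hd _ _ ineqj)))) _.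
rewrite eqxx (negbTE ineqj) !mulr0 !mulr1 !add0r addr0.
have d0 := dist2_circle_neq0 ineqj.
rewrite aside_circle ahead_circle; move: d0; rewrite dist2_circle => d0.
have c0 : 1 - cos (p j - p i) != 0 by rewrite subr_eq0 eq_sym p_sep.
by field; rewrite c0 k_neq0.
Qed.

Lemma field_jacobian : exists (A : 'M[R]_(n + n + n)) (K d0 : R),
  [/\ 0 < d0, \tr A = n%:R / 2 - 2 * v * k * \sum_i slope i &
   forall (h h' : 'rV[R]_(n + n + n)) (d D : R), d <= d0 ->
    (forall l, `|h 0 l| <= d) -> (forall l, `|h' 0 l| <= d) ->
    (forall l, `|h 0 l - h' 0 l| <= D) ->
    forall l, `|field (circle p + h) 0 l - field (circle p + h') 0 l - ((h - h') *m A) 0 l| <= K * d * D].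
Proof.
have [|A [K [d0 [d00 trA AP]]]] := @exists_jacobian R _ (circle p) field
   (fun l => node (fun=> 0) (fun=> 0) (fun i => 1 / 2 - 2 * v * k * slope i) 0 l).
  move=> l; case: (split_ordP l) => [l' ->|i ->]; last first.
    rewrite -/(heading _ _) heading_node.
    apply: has_partial_ext (has_partial_turn i) => y.
    by rewrite -[RHS]/(heading (field y) i) heading_node.
  case: (split_ordP l') => [i ->|i ->].
    rewrite -/(posx _ _) posx_node.
    apply: has_partial_eq (has_partial_ext _ (has_partialD
      (has_partialZ v (has_partial_cos (has_partial_heading _ _ i)))
      (has_partialZ (v / k) (has_partial_posy _ _ i)))) _.
      by move=> y; rewrite -[RHS]/(posx (field y) i) posx_node.
    by rewrite eq_lrshift (inj_eq (@lshift_inj _ _)) eq_lrshift !mulr0 addr0.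
  rewrite -/(posy _ _) posy_node.
  apply: has_partial_eq (has_partial_ext _ (has_partialB
      (has_partialZ v (has_partial_sin (has_partial_heading _ _ i)))
      (has_partialZ (v / k) (has_partial_posx _ _ i)))) _.
    by move=> y; rewrite -[RHS]/(posy (field y) i) posy_node.
  by rewrite eq_lrshift (inj_eq (@lshift_inj _ _)) eq_sym eq_lrshift !mulr0 subr0.
exists A, K, d0; split=> //; rewrite trA !big_split_ord/=.
rewrite (eq_bigr (fun=> 0)) => [|i _]; last by rewrite -/(posx _ _) posx_node.
rewrite big1 => [|//]; rewrite (eq_bigr (fun=> 0)) => [|i _]; last by rewrite -/(posy _ _) posy_node.
rewrite big1 => [|//]; rewrite !add0r.
rewrite (eq_bigr (fun i => 1 / 2 - 2 * v * k * slope i)) => [|i _]; last by rewrite -/(heading _ _) heading_node.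
rewrite sumrB mulr_sumr; congr (_ - _).
by rewrite sumr_const card_ord mul1r mulr_natl.
Qed.

End Equilibrium.

End Model.

(** * Edge coordinates *)

Section Lift.
Context {R : realType} {n : nat}.
Implicit Types (x : 'rV[R]_(n + n + n)) (i j : 'I_n).
Variables (v k : R) (e : rel 'I_n) (p : 'I_n -> R).
Hypothesis k_neq0 : k != 0.
Hypothesis e_sym : symmetric e.
Hypothesis e_irr : irreflexive e.
Hypothesis p_inj : injective p.
Hypothesis p_close : forall i j, `|p j - p i| < 2.

(* The angle of the chord from i to j of the circular formation, chosen so that
   its values at (i, j) and (j, i) differ by pi *)
Definition chord_angle i j : R :=
  (p i + p j) / 2 + (if 0 < k * (p j - p i) then 0 else pi).

Definition along x i j := relx x i j * cos (chord_angle i j) + rely x i j * sin (chord_angle i j).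
Definition across x i j := rely x i j * cos (chord_angle i j) - relx x i j * sin (chord_angle i j).

(* Where the direction from i to j is within pi / 2 of the reference chord, atan
   gives a smooth real lift of the bearing. *)
Definition bearing x i j : R :=
  chord_angle i j - heading x i + atan (across x i j / along x i j).

Definition lift x : state R n :=
  (\matrix_(i, j) (if e i j then Num.sqrt (dist2 x i j) else 0),
   \matrix_(i, j) (if e i j then bearing x i j else 0)).

(** An open condition under which [bearing] is a true bearing. It ranges over all pairs, not only
    edges, so that it also excludes overlap. *)
Definition facing x := forall i j, i != j -> 0 < along x i j.

Lemma rho_lift x i j : e i j -> rho (lift x) i j = Num.sqrt (dist2 x i j).
Proof. by move=> ij; rewrite /rho mxE ij. Qed.

Lemma alpha_lift x i j : e i j -> alpha (lift x) i j = bearing x i j.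
Proof. by move=> ij; rewrite /alpha mxE ij. Qed.

Lemma e_neq i j : e i j -> i != j.
Proof. by apply: contraTneq => ->; rewrite e_irr. Qed.

Lemma dist2C x i j : dist2 x i j = dist2 x j i.
Proof. by rewrite /dist2 /relx /rely; ring. Qed.

Lemma dist2_along x i j : dist2 x i j = along x i j ^+ 2 + across x i j ^+ 2.
Proof.
have c := cos2Dsin2 (chord_angle i j).
transitivity (dist2 x i j * (cos (chord_angle i j) ^+ 2 + sin (chord_angle i j) ^+ 2)).
  by rewrite c mulr1.
by rewrite /along /across /dist2; ring.
Qed.

Lemma dist2_gt0 x i j : facing x -> i != j -> 0 < dist2 x i j.
Proof.
move=> fx ij; rewrite dist2_along ltr_pwDl// ?exprn_gt0 ?fx// exprn_even_ge0//.
Qed.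

Lemma cos_atan_div (a b : R) : 0 < a ->
  Num.sqrt (a ^+ 2 + b ^+ 2) * cos (atan (b / a)) = a /\
  Num.sqrt (a ^+ 2 + b ^+ 2) * sin (atan (b / a)) = b.
Proof.
move=> a0; have an0 : a != 0 by exact: lt0r_neq0.
have s0 : 0 < Num.sqrt (1 + (b / a) ^+ 2) by rewrite sqrtr_gt0 ltr_pwDl// exprn_even_ge0.
have c0 : cos (atan (b / a)) != 0 by rewrite cos_atan invr_eq0 lt0r_neq0.
have h : Num.sqrt (a ^+ 2 + b ^+ 2) * cos (atan (b / a)) = a.
  rewrite cos_atan (_ : a ^+ 2 + b ^+ 2 = a ^+ 2 * (1 + (b / a) ^+ 2)); last by field.
  rewrite sqrtrM ?sqr_ge0// sqrtr_sqr gtr0_norm// mulfK// lt0r_neq0//.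
split=> //; have : sin (atan (b / a)) = b / a * cos (atan (b / a)).
  by rewrite -{2}[b / a]atanK /tan divfK.
by move=> ->; rewrite mulrCA h divfK.
Qed.

Lemma polar_rel x i j : 0 < along x i j ->
  relx x i j = Num.sqrt (dist2 x i j) * cos (heading x i + bearing x i j) /\
  rely x i j = Num.sqrt (dist2 x i j) * sin (heading x i + bearing x i j).
Proof.
move=> al0; have [hc hs] := cos_atan_div (across x i j) al0.
rewrite -dist2_along in hc hs.
have c1 := cos2Dsin2 (chord_angle i j).
rewrite /bearing addrA (addrC (heading x i)) subrK.
set r := Num.sqrt _ in hc hs *; set b := chord_angle i j in c1 *.
set t := atan _ in hc hs *.
rewrite (cosD b t) (sinD b t) mulrBr mulrDr !(mulrCA r) hc hs /along /across -/b.
by split; rewrite -[LHS]mulr1 -c1; ring.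
Qed.

Lemma rho_cos_bearing x i j : 0 < along x i j ->
  Num.sqrt (dist2 x i j) * cos (bearing x i j) = ahead x i j /\
  Num.sqrt (dist2 x i j) * sin (bearing x i j) = aside x i j.
Proof.
move=> /polar_rel[rx ry].
have -> : bearing x i j = heading x i + bearing x i j - heading x i by rewrite addrC addKr.
by rewrite cosB sinB /ahead /aside rx ry; split; ring.
Qed.

Lemma lift_realizes x : facing x ->
  realizes e (fun i => (posx x i, posy x i)) (heading x) (lift x).
Proof.
move=> fx i j; case: ifPn => ij; last by rewrite /rho /alpha !mxE (negbTE ij).
have [rx ry] := polar_rel (fx _ _ (e_neq ij)).
by rewrite rho_lift// alpha_lift//; split.
Qed.

Lemma lift_manifold x : facing x -> manifold e (lift x).
Proof.
move=> fx; exists (fun i => (posx x i, posy x i)), (heading x).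
split; last exact: lift_realizes.
move=> i j [hx hy]; apply/eqP; apply: contraT => /fx.
by rewrite /along /relx /rely hx hy !subrr !mul0r addr0 ltxx.
Qed.

Lemma omega_lift x i : facing x -> omega v k e (lift x) i = turn v k e x i.
Proof.
move=> fx; rewrite /omega /turn; congr (_ * _); apply: eq_bigr => j ij.
have ji : e j i by rewrite e_sym.
have [hc hs] := rho_cos_bearing (fx _ _ (e_neq ij)).
have [hc' hs'] := rho_cos_bearing (fx _ _ (e_neq ji)).
rewrite rho_lift// !alpha_lift//.
have d0 := dist2_gt0 fx (e_neq ij).
have r0 : Num.sqrt (dist2 x i j) != 0 by rewrite lt0r_neq0// sqrtr_gt0.
rewrite (dist2C x j i) in hc'; rewrite -hc -hs -hc'.
have := sqr_sqrtr (ltW d0); move: (Num.sqrt (dist2 x i j)) r0 => r r0 <-.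
by field.
Qed.

Lemma sinB_half (a b : R) : sin b - sin a = 2 * sin ((b - a) / 2) * cos ((a + b) / 2).
Proof.
rewrite -[in sin b](_ : (a + b) / 2 + (b - a) / 2 = b); last by field.
rewrite -[in sin a](_ : (a + b) / 2 - (b - a) / 2 = a); last by field.
by rewrite sinD sinB; ring.
Qed.

Lemma cosB_half (a b : R) : cos b - cos a = - (2 * sin ((b - a) / 2) * sin ((a + b) / 2)).
Proof.
rewrite -[in cos b](_ : (a + b) / 2 + (b - a) / 2 = b); last by field.
rewrite -[in cos a](_ : (a + b) / 2 - (b - a) / 2 = a); last by field.
by rewrite cosD cosB; ring.
Qed.

Lemma sin_half_gt0 i j : p i < p j -> 0 < sin ((p j - p i) / 2).
Proof.
move=> ij; apply: sin2_gt0; have := p_close i j; rewrite ltr_norml; lra.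
Qed.

(** The chord from i to j is 2 k sin((p j - p i) / 2) times the unit vector at the mean phase; the
    sign of this factor decides whether [chord_angle] needs the half turn. Phases less than 2 apart
    keep the half difference in (-1, 1), where the sine has the sign of its argument. *)
Lemma k_sin_half i j : i != j ->
  if 0 < k * (p j - p i) then 0 < k * sin ((p j - p i) / 2)
  else k * sin ((p j - p i) / 2) < 0.
Proof.
move=> ij; have pij : p i != p j by apply: contra_neq ij => /p_inj.
have [pp|pp] : p i < p j \/ p j < p i by case: ltgtP pij; [left|right|].
  have s0 := sin_half_gt0 pp; have d0 : 0 < p j - p i by rewrite subr_gt0.
  rewrite !pmulr_lgt0// pmulr_llt0//; case: ifPn => //.
  by rewrite -leNgt le_eqVlt (negbTE k_neq0).
have s0 := sin_half_gt0 pp; have d0 : p j - p i < 0 by rewrite subr_lt0.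
have s1 : sin ((p j - p i) / 2) < 0.
  by rewrite -opprB mulNr sinN oppr_lt0.
rewrite !nmulr_lgt0// nmulr_llt0//; case: ifPn => //.
by rewrite -leNgt le_eqVlt eq_sym (negbTE k_neq0).
Qed.

Lemma p_sep i j : i != j -> cos (p j - p i) != 1.
Proof.
move=> ij; have s0 : sin ((p j - p i) / 2) != 0.
  have := k_sin_half ij; case: ifP => _ h; apply/eqP => s0; by move: h; rewrite s0 mulr0 ltxx.
rewrite (_ : p j - p i = (p j - p i) / 2 *+ 2); last by rewrite -mulr_natr; field.
rewrite cos_mulr2n cos2sin2 -subr_eq0; rewrite (_ : _ - _ = - 2 * sin ((p j - p i) / 2) ^+ 2); last by ring.
by rewrite mulf_neq0 ?oppr_eq0// expf_neq0.
Qed.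

Lemma along_circle i j : i != j -> 0 < along (circle k p) i j /\ across (circle k p) i j = 0.
Proof.
move=> ij; have := k_sin_half ij.
rewrite /along /across relx_circle rely_circle sinB_half cosB_half /chord_angle.
have := cos2Dsin2 ((p i + p j) / 2).
set s := sin ((p j - p i) / 2); set c := cos _; set d := sin ((p i + p j) / 2) => c1.
case: ifPn => _ h; rewrite ?addr0 ?cosDpi ?sinDpi -/c -/d.
  split; last by ring.
  rewrite (_ : _ + _ = 2 * (k * s) * (c ^+ 2 + d ^+ 2)); last by ring.
  by rewrite c1 mulr1 mulr_gt0.
split; last by ring.
rewrite (_ : _ + _ = 2 * - (k * s) * (c ^+ 2 + d ^+ 2)); last by ring.
by rewrite c1 mulr1 mulr_gt0// oppr_gt0.
Qed.

Lemma facing_circle : facing (circle k p).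
Proof. by move=> i j /along_circle[]. Qed.

Lemma chord_angleC i j : i != j -> chord_angle i j + chord_angle j i = p i + p j + pi.
Proof.
move=> ij; have pij : p i != p j by apply: contra_neq ij => /p_inj.
rewrite /chord_angle -[p i - p j]opprB mulrN oppr_gt0.
have : k * (p j - p i) != 0 by rewrite mulf_neq0// subr_eq0 eq_sym.
by case: ltgtP => // _ _; field.
Qed.

Lemma ratio_circle : common_ratio e (lift (circle k p)) (1 / (2 * k)).
Proof.
move=> i j ij; rewrite rho_lift// alpha_lift//; have ineqj := e_neq ij.
have [hc hs] := rho_cos_bearing (facing_circle ineqj).
have d0 := dist2_gt0 facing_circle ineqj.
have r0 : Num.sqrt (dist2 (circle k p) i j) != 0 by rewrite lt0r_neq0// sqrtr_gt0.
have -> : sin (bearing (circle k p) i j) = aside (circle k p) i j / Num.sqrt (dist2 (circle k p) i j).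
  by rewrite -hs mulrC mulKf.
rewrite -mulrA -invfM -expr2 sqr_sqrtr ?ltW// aside_circle dist2_circle.
have c0 : 1 - cos (p j - p i) != 0 by rewrite subr_eq0 eq_sym p_sep.
by field; rewrite c0 k_neq0.
Qed.

Lemma Xi_circle : Xi e (lift (circle k p)).
Proof.
split; [exact: lift_manifold facing_circle| |by exists (1 / (2 * k)); exact: ratio_circle].
move=> i j ij; have ji : e j i by rewrite e_sym.
(* No multiple of 2 pi appears: the two chord angles add up to p i + p j + pi, and the headings
   remove p i + p j. *)
exists 0; rewrite mul0r addr0 !alpha_lift// /bearing.
have [_ ->] := along_circle (e_neq ij); have [_ ->] := along_circle (e_neq ji).
rewrite !mul0r atan0 !heading_node !addr0 addrACA chord_angleC ?e_neq//; ring.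
Qed.

(** * The lifted curve solves the closed-loop equations *)

Section Derivatives.
Variables (x : R -> 'rV[R]_(n + n + n)) (t : R).
Hypothesis dx : forall l, is_derive t 1 (fun u => x u 0 l) (field v k e (x t) 0 l).
Hypothesis fx : facing (x t).

Lemma is_derive_heading i : is_derive t 1 (fun u => heading (x u) i) (turn v k e (x t) i - v / k).
Proof. by apply: is_derive_eq (dx _) _; rewrite -/(heading _ _) heading_node. Qed.

Lemma is_derive_relx i j : is_derive t 1 (fun u => relx (x u) i j)
  (v * (cos (heading (x t) j) - cos (heading (x t) i)) + v / k * rely (x t) i j).
Proof.
apply: is_derive_eq (is_deriveB (dx _) (dx _)) _.
by rewrite -!/(posx _ _) !posx_node /rely; ring.
Qed.

Lemma is_derive_rely i j : is_derive t 1 (fun u => rely (x u) i j)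
  (v * (sin (heading (x t) j) - sin (heading (x t) i)) - v / k * relx (x t) i j).
Proof.
apply: is_derive_eq (is_deriveB (dx _) (dx _)) _.
by rewrite -!/(posy _ _) !posy_node /relx; ring.
Qed.

(** The terms due to the turning plane cancel, a rotation being an isometry. *)
Lemma is_derive_dist2 i j : is_derive t 1 (fun u => dist2 (x u) i j)
  (- 2 * v * (ahead (x t) i j + ahead (x t) j i)).
Proof.
have hx := is_derive_relx i j; have hy := is_derive_rely i j.
apply: is_derive_eq (is_deriveD (is_deriveM hx hx) (is_deriveM hy hy)) _.
by rewrite /GRing.scale/= /ahead /relx /rely; ring.
Qed.

Lemma is_derive_rho_lift i j : e i j ->
  is_derive t 1 (fun u => rho (lift (x u)) i j) (rho_dot v (lift (x t)) i j).
Proof.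
move=> ij; have ji : e j i by rewrite e_sym.
under eq_fun do rewrite rho_lift//.
have d0 := dist2_gt0 fx (e_neq ij).
have r0 : Num.sqrt (dist2 (x t) i j) != 0 by rewrite lt0r_neq0// sqrtr_gt0.
have [hc _] := rho_cos_bearing (fx (e_neq ij)).
have [hc' _] := rho_cos_bearing (fx (e_neq ji)); rewrite (dist2C _ j i) in hc'.
have h := @is_derive1_comp R Num.sqrt (fun u => dist2 (x u) i j) t _ _
  (is_derive1_sqrt d0) (is_derive_dist2 i j).
apply: is_derive_eq h _; rewrite /rho_dot !alpha_lift// -hc -hc'.
by move: (Num.sqrt _) r0 => r r0; field.
Qed.

(** The direction (X, Y) from i to j turns at the rate (X Y' - Y X') / dist2, whatever the reference
    angle. The turning plane contributes - v / k to this rate and to that of the heading, so it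
    drops out of the bearing. *)
Lemma is_derive_alpha_lift i j : e i j ->
  is_derive t 1 (fun u => alpha (lift (x u)) i j) (alpha_dot v k e (lift (x t)) i j).
Proof.
move=> ij; have ji : e j i by rewrite e_sym.
under eq_fun do rewrite alpha_lift//.
have d0 := dist2_gt0 fx (e_neq ij).
have hx := is_derive_relx i j; have hy := is_derive_rely i j.
have al0 := lt0r_neq0 (fx (e_neq ij)).
pose b := chord_angle i j; have c1 := cos2Dsin2 b.
have ha := is_deriveD (is_derive_scaler (cos b) hx) (is_derive_scaler (sin b) hy).
have hc := is_deriveB (is_derive_scaler (cos b) hy) (is_derive_scaler (sin b) hx).
have hq : is_derive t 1 (fun u => across (x u) i j / along (x u) i j)
  ((1 + (across (x t) i j / along (x t) i j) ^+ 2) *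
   ((v * (aside (x t) i j + aside (x t) j i)) / dist2 (x t) i j - v / k)).
  have h := is_deriveM hc (is_deriveV (f := fun u => along (x u) i j) al0 ha).
  apply: is_derive_eq h _; rewrite /GRing.scale/= -/(across (x t) i j).
  have d1 := lt0r_neq0 d0.
  have -> : 1 + (across (x t) i j / along (x t) i j) ^+ 2 = dist2 (x t) i j / along (x t) i j ^+ 2.
    by rewrite dist2_along; field.
  set X' := v * _ + v / k * _; set Y' := v * _ - v / k * _.
  (* The determinant of (X, Y) and (X', Y') is unchanged by the rotation to the chord frame. *)
  have e1 : (Y' * cos b - X' * sin b) * along (x t) i j -
      across (x t) i j * (X' * cos b + Y' * sin b) = relx (x t) i j * Y' - rely (x t) i j * X'.
    by rewrite -[RHS]mulr1 -c1 /along /across -/b; ring.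
  have e2 : relx (x t) i j * Y' - rely (x t) i j * X' =
      v * (aside (x t) i j + aside (x t) j i) - v / k * dist2 (x t) i j.
    by rewrite /X' /Y' /aside /dist2 /relx /rely; ring.
  rewrite !fctE -/(along (x t) i j) -/(across (x t) i j).
  transitivity (((Y' * cos b - X' * sin b) * along (x t) i j -
      across (x t) i j * (X' * cos b + Y' * sin b)) / along (x t) i j ^+ 2).
    by field.
  by rewrite e1 e2; field; rewrite k_neq0 al0 d1.
have hat := @is_derive1_comp R atan (fun u => across (x u) i j / along (x u) i j) t _ _
  (is_derive1_atan _) hq.
have hh := is_deriveD (is_deriveB (is_derive_cst b t 1) (is_derive_heading i)) hat.
apply: is_derive_eq hh _.
rewrite /alpha_dot omega_lift// !alpha_lift// rho_lift//.
have r0 : Num.sqrt (dist2 (x t) i j) != 0 by rewrite lt0r_neq0// sqrtr_gt0.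
have [_ hs] := rho_cos_bearing (fx (e_neq ij)).
have [_ hs'] := rho_cos_bearing (fx (e_neq ji)); rewrite (dist2C _ j i) in hs'.
rewrite mulKf; last by rewrite lt0r_neq0// ltr_pwDl// exprn_even_ge0.
rewrite -hs -hs' -{3}(sqr_sqrtr (ltW d0)).
by move: (Num.sqrt _) r0 => r r0; field; rewrite r0 k_neq0.
Qed.

End Derivatives.

End Lift.

(** * The closure of a set of formations *)

Section Assembly.
Context {R : realType} {n : nat}.

Lemma cos_2pi_int (y : R) (m : int) : cos (y + m%:~R * (2 * pi)) = cos y.
Proof.
have nat_period (y' : R) N : cos (y' + N%:R * (2 * pi)) = cos y'.
  by rewrite (_ : N%:R * _ = pi *+ 2 *+ N); [rewrite periodicn//; exact: cosD2pi|rewrite !mulr_natl].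
case: m => m; first by rewrite -pmulrn nat_period.
by rewrite NegzE mulrNz -pmulrn -[LHS](nat_period _ m.+1) mulNr addrNK.
Qed.

Lemma derive0_limit (f : R -> R) (T l : R) :
  (forall t, t < T -> is_derive t 1 f 0) -> f t @[t --> -oo] --> l ->
  forall t, t < T -> f t = l.
Proof.
move=> df fl t tT; apply/eqP; rewrite -subr_eq0 -normr_le0; apply/ler_addgt0Pr => r r0.
rewrite add0r distrC.
have /cvgrPdist_le/(_ _ r0) near1 := fl.
have near2 : \forall s \near -oo, s <= t by apply: nbhs_ninfty_le; exact: num_real.
have [s [s1 s2]] : exists s, `|l - f s| <= r /\ s <= t.
  by have [s hs] := filter_ex (filterI near1 near2); exists s.
suff -> : f t = f s by [].
have dst u : u \in `]s, t[%R -> is_derive u 1 f 0.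
  by rewrite in_itv /= => /andP[_ ut]; apply: df; exact: lt_trans ut tT.
have cst : {within `[s, t], continuous f}.
  apply: continuous_in_subspaceT => u; rewrite inE /= in_itv /= => /andP[_ ut].
  exact: is_derive_continuous (df u (le_lt_trans ut tT)).
have [_ _ h] := MVT_segment s2 dst cst.
by apply/eqP; rewrite -subr_eq0 h mul0r.
Qed.

Lemma slopeN (k : R) (e : rel 'I_n) (p : 'I_n -> R) i :
  slope k e (fun i => - p i) i = - slope k e p i.
Proof.
rewrite /slope -mulrN -sumrN; congr (_ * _); apply: eq_bigr => j _.
rewrite !dist2_circle (_ : - p j - - p i = - (p j - p i)); last by ring.
by rewrite sinN cosN mulNr.
Qed.

Lemma exists_phases (v k : R) (e : rel 'I_n) : exists p : 'I_n -> R,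
  [/\ injective p, forall i j, `|p j - p i| < 2 &
      2 * v * k * \sum_i slope k e p i <= 0].
Proof.
(* Distinct phases in [0, 1): both separation and closeness survive the reflection p -> - p. *)
pose p (i : 'I_n) : R := i%:R / n%:R.
have n0 (i : 'I_n) : 0 < n%:R :> R by rewrite ltr0n (leq_ltn_trans _ (ltn_ord i)).
have p01 i : 0 <= p i < 1.
  rewrite divr_ge0//= ltr_pdivrMr ?(n0 i)// mul1r ltr_nat; exact: ltn_ord.
have pI : injective p.
  move=> i j /(congr1 (fun y => y * n%:R)); rewrite !divfK ?lt0r_neq0 ?(n0 i)//.
  by move=> /eqP; rewrite eqr_nat => /eqP/val_inj.
have pc i j : `|p j - p i| < 2.
  by clear n0; rewrite ltr_norml; have /andP[? ?] := p01 i; have /andP[? ?] := p01 j; lra.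
have [h|/ltW h] := leP (2 * v * k * \sum_i slope k e p i) 0; first by exists p.
exists (fun i => - p i); split.
- by move=> i j /oppr_inj/pI.
- by move=> i j; rewrite -opprD normrN pc.
- by rewrite (eq_bigr _ (fun i _ => slopeN k e p i)) sumrN mulrN oppr_le0.
Qed.

Variables (v k : R) (e : rel 'I_n).
Hypothesis k_neq0 : k != 0.
Hypothesis e_sym : symmetric e.
Hypothesis e_irr : irreflexive e.

Lemma Xi_cos (c : state R n) i j : Xi e c -> e i j -> cos (alpha c i j) + cos (alpha c j i) = 0.
Proof.
move=> [_ h _] /h[m hm]; have -> : alpha c i j = pi - alpha c j i + m%:~R * (2 * pi).
  by apply: (addIr (alpha c j i)); rewrite hm; ring.
by rewrite cos_2pi_int (addrC pi) cosDpi cosN addNr.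
Qed.

Lemma manifold_rho_neq0 (c : state R n) i j : manifold e c -> e i j -> rho c i j != 0.
Proof.
move=> [z [th [zI zr]]] ij; apply/eqP => r0; have := zr i j; rewrite ij r0 !mul0r => -[_].
move=> /eqP; rewrite subr_eq0 => /eqP h1 /eqP; rewrite subr_eq0 => /eqP h2.
have : z j = z i by case: (z j) (z i) h1 h2 => ? ? [? ?] /= -> ->.
by move=> /zI ji; move: ij; rewrite ji e_irr.
Qed.

Lemma adherent_eq0 (C : set (state R n)) (xi : state R n) (g : state R n -> R) :
  (forall eps, 0 < eps -> neighborhood C eps xi) -> (forall c, C c -> g c = 0) ->
  g y @[y --> xi] --> g xi -> g xi = 0.
Proof.
move=> hC g0 /cvgrPdist_le gc; apply/eqP; rewrite -normr_le0; apply/ler_addgt0Pr => r r0.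
have /nbhs_ballP[d /= d0 dP] := gc _ r0.
have [c Cc /ball_sym/dP] := hC d d0.
by rewrite /= (g0 c Cc) subr0 add0r.
Qed.

Lemma cvg_rho (xi : state R n) i j : rho y i j @[y --> xi] --> rho xi i j.
Proof.
apply/cvgrPdist_lt => r r0; apply: filterS (nbhsx_ballx xi r r0) => y [[_ h] _]; exact: h.
Qed.

Lemma cvg_alpha (xi : state R n) i j : alpha y i j @[y --> xi] --> alpha xi i j.
Proof.
apply/cvgrPdist_lt => r r0; apply: filterS (nbhsx_ballx xi r r0) => y [_ [_ h]]; exact: h.
Qed.

Section Adherence.
Variables (C : set (state R n)) (p : 'I_n -> R) (x : 'rV[R]_(n + n + n)).
Hypothesis C_sub : C `<=` Xi e.
Hypothesis fx : facing k p x.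
Hypothesis C_adh : forall eps, 0 < eps -> neighborhood C eps (lift k e p x).

Lemma adherent_cos i j : e i j ->
  cos (alpha (lift k e p x) i j) + cos (alpha (lift k e p x) j i) = 0.
Proof.
move=> ij.
apply: (adherent_eq0 (g := fun y => cos (alpha y i j) + cos (alpha y j i)) C_adh) => [c /C_sub cX|].
  exact: Xi_cos cX ij.
by apply: cvgD; apply: continuous_cvg; (exact: continuous_cos || exact: cvg_alpha).
Qed.

(** The common ratio varies with the approximating formation, so no limit of it is taken:
    cross-multiplying two edges eliminates it and leaves an identity continuous in the state. *)
Lemma adherent_ratio i j a b : e i j -> e a b ->
  sin (alpha (lift k e p x) i j) / rho (lift k e p x) i j =
  sin (alpha (lift k e p x) a b) / rho (lift k e p x) a b.
Proof.
move=> ij ab.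
have r0 : rho (lift k e p x) i j != 0.
  by rewrite rho_lift// lt0r_neq0// sqrtr_gt0; apply: dist2_gt0 fx _; exact: (e_neq e_irr).
have r0' : rho (lift k e p x) a b != 0.
  by rewrite rho_lift// lt0r_neq0// sqrtr_gt0; apply: dist2_gt0 fx _; exact: (e_neq e_irr).
apply/eqP; rewrite eqr_div// -subr_eq0; apply/eqP.
apply: (adherent_eq0 (g := fun y => sin (alpha y i j) * rho y a b - sin (alpha y a b) * rho y i j) C_adh).
  move=> c /C_sub[cm _ [s cs]].
  have r1 := manifold_rho_neq0 cm ij; have r2 := manifold_rho_neq0 cm ab.
  have h1 : sin (alpha c i j) = s * rho c i j by rewrite -(cs i j ij) divfK.
  have h2 : sin (alpha c a b) = s * rho c a b by rewrite -(cs a b ab) divfK.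
  by rewrite h1 h2; ring.
by apply: cvgB; apply: cvgM; (exact: cvg_rho || (apply: continuous_cvg; (exact: continuous_sin || exact: cvg_alpha))).
Qed.

(** Once the cosines cancel, the control law is 2 v s with s the common ratio, and the two sine
    terms of the bearing rate give v s each, as distances are symmetric. *)
Lemma adherent_equilibrium i j : e i j ->
  rho_dot v (lift k e p x) i j = 0 /\ alpha_dot v k e (lift k e p x) i j = 0.
Proof.
move=> ij; have ji : e j i by rewrite e_sym.
rewrite /rho_dot adherent_cos// mulr0; split=> //.
set s := sin (alpha (lift k e p x) i j) / rho (lift k e p x) i j.
have om : omega v k e (lift k e p x) i = 2 * v * s.
  rewrite /omega (eq_bigr (fun=> 2 * v * s)) => [|a ia]; first by apply: mean_cst; exists j.
  by rewrite adherent_cos// mulr0 addr0 -mulrA (mulrC _^-1) (adherent_ratio ia ij).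
rewrite /alpha_dot om mulrDr.
have -> : v / rho (lift k e p x) i j * sin (alpha (lift k e p x) i j) = v * s.
  by rewrite /s -mulrA (mulrC _^-1).
have -> : v / rho (lift k e p x) i j * sin (alpha (lift k e p x) j i) = v * s.
  rewrite /s (adherent_ratio ij ji) -mulrA (mulrC _^-1) !rho_lift//.
  by rewrite (dist2C x j i).
by ring.
Qed.

End Adherence.

End Assembly.

(** * Instability *)

Section Instability.
Context {R : realType} {n : nat}.
Variables (v k : R) (e : rel 'I_n) (p : 'I_n -> R).
Hypothesis k_neq0 : k != 0.
Hypothesis e_sym : symmetric e.
Hypothesis e_irr : irreflexive e.
Hypothesis p_inj : injective p.
Hypothesis p_close : forall i j, `|p j - p i| < 2.

(** * Limits of the edge coordinates along a filter, at -oo or at a given time *)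

Section Curve.
Variables (x : R -> 'rV[R]_(n + n + n)) (F : set_system R).
Context {FF : ProperFilter F}.
Variable y : 'rV[R]_(n + n + n).
Hypothesis xy : forall l, x t 0 l @[t --> F] --> y 0 l.

Lemma cvg_relx i j : relx (x t) i j @[t --> F] --> relx y i j.
Proof. by apply: cvgB; exact: xy. Qed.

Lemma cvg_rely i j : rely (x t) i j @[t --> F] --> rely y i j.
Proof. by apply: cvgB; exact: xy. Qed.

Lemma cvg_along i j : along k p (x t) i j @[t --> F] --> along k p y i j.
Proof. by apply: cvgD; apply: cvgMl; [exact: cvg_relx|exact: cvg_rely]. Qed.

Lemma cvg_across i j : across k p (x t) i j @[t --> F] --> across k p y i j.
Proof. by apply: cvgB; apply: cvgMl; [exact: cvg_rely|exact: cvg_relx]. Qed.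

Lemma near_facing : facing k p y -> \forall t \near F, facing k p (x t).
Proof.
move=> fy.
have h (ij : 'I_n * 'I_n) : \forall t \near F, ij.1 != ij.2 -> 0 < along k p (x t) ij.1 ij.2.
  have [->|ij0] := eqVneq ij.1 ij.2; first exact: filterE.
  have g : \forall t \near F, 0 < along k p (x t) ij.1 ij.2.
    exact: (cvgr_gt _ (cvg_along (i := ij.1) (j := ij.2)) _ (fy _ _ ij0)).
  by apply: filterS g => t ? _.
by apply: filterS (filter_forall _ h) => t ht i j; exact: (ht (i, j)).
Qed.

Lemma cvg_rho_lift i j : rho (lift k e p (x t)) i j @[t --> F] --> rho (lift k e p y) i j.
Proof.
have [ij|ij] := boolP (e i j); last first.
  rewrite /rho mxE (negbTE ij); under eq_fun do rewrite mxE (negbTE ij).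
  exact: cvg_cst.
rewrite rho_lift//; under eq_fun do rewrite rho_lift//.
apply: continuous_cvg; first exact: sqrt_continuous.
by apply: cvgD; apply: cvgM; (exact: cvg_relx || exact: cvg_rely).
Qed.

Lemma cvg_alpha_lift i j : facing k p y ->
  alpha (lift k e p (x t)) i j @[t --> F] --> alpha (lift k e p y) i j.
Proof.
move=> fy; have [ij|ij] := boolP (e i j); last first.
  rewrite /alpha mxE (negbTE ij); under eq_fun do rewrite mxE (negbTE ij).
  exact: cvg_cst.
rewrite alpha_lift//; under eq_fun do rewrite alpha_lift//.
apply: cvgD; first by apply: cvgB; [exact: cvg_cst|exact: xy].
apply: continuous_cvg; first exact: continuous_atan.
apply: cvgM; first exact: cvg_across.
by apply: cvgV; [rewrite lt0r_neq0// fy// (e_neq e_irr)|exact: cvg_along].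
Qed.

Lemma cvg_lift : facing k p y -> lift k e p (x t) @[t --> F] --> lift k e p y.
Proof.
move=> fy; apply/cvg_ballP => eps eps0.
have h1 (ij : 'I_n * 'I_n) : \forall t \near F,
    ball (rho (lift k e p y) ij.1 ij.2) eps (rho (lift k e p (x t)) ij.1 ij.2).
  by have /cvg_ballP := cvg_rho_lift (i := ij.1) (j := ij.2); exact.
have h2 (ij : 'I_n * 'I_n) : \forall t \near F,
    ball (alpha (lift k e p y) ij.1 ij.2) eps (alpha (lift k e p (x t)) ij.1 ij.2).
  by have /cvg_ballP := cvg_alpha_lift (i := ij.1) (j := ij.2) fy; exact.
apply: filterS (filterI (filter_forall _ h1) (filter_forall _ h2)) => t [t1 t2].
by split; split=> // i j; [exact: (t1 (i, j))|exact: (t2 (i, j))].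
Qed.

End Curve.

(** The sum of squares u^2 + w^2 is conserved and tends to 0 at -oo. *)
Lemma rotation_limit (u w : R -> R) (a T : R) :
  (forall t, t < T -> is_derive t 1 u (a * w t)) ->
  (forall t, t < T -> is_derive t 1 w (- (a * u t))) ->
  u t @[t --> -oo] --> (0 : R) -> w t @[t --> -oo] --> (0 : R) ->
  forall t, t < T -> u t = 0 /\ w t = 0.
Proof.
move=> du dw u0 w0 t tT.
have d s : s < T -> is_derive s 1 (fun s => u s * u s + w s * w s) 0.
  move=> sT; apply: is_derive_eq (is_deriveD (is_deriveM (du s sT) (du s sT)) (is_deriveM (dw s sT) (dw s sT))) _.
  by rewrite /GRing.scale/=; ring.
have l : (u s * u s + w s * w s) @[s --> -oo] --> (0 : R).
  rewrite -[X in _ --> X](_ : 0 * 0 + 0 * 0 = 0 :> R); last by ring.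
  by apply: cvgD; apply: cvgM.
have := derive0_limit d l tT; rewrite -!expr2 => /eqP.
by rewrite paddr_eq0 ?sqr_ge0// !sqrf_eq0 => /andP[/eqP -> /eqP ->].
Qed.

Lemma unstable_formations (C : set (state R n)) : (0 < n)%N ->
  (forall i, exists j, e i j) -> 2 * v * k * \sum_i slope k e p i <= 0 ->
  C `<=` Xi e -> C (lift k e p (circle k p)) -> unstable v k e C.
Proof.
move=> n0 e_nbr sl C_sub C_circle stab.
have sep := p_sep k_neq0 p_inj p_close.
have fc := facing_circle k_neq0 p_inj p_close.
have [A [K [d0 [d00 trA AP]]]] := field_jacobian v k_neq0 e_irr e_nbr sep.
have tr0 : 0 < \tr A.
  by rewrite trA subr_gt0 (le_lt_trans sl)// divr_gt0// ltr0n.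
have [x [T [dx xlim xnc]]] := exists_unstable_curve d00 (field_circle v k_neq0 e_irr e_nbr sep) AP tr0.
have cx l : x t 0 l @[t --> -oo] --> circle k p 0 l.
  apply/cvgrPdist_le => r /xlim[T' T'P].
  by exists T'; split; [exact: num_real|move=> t /T'P; rewrite distrC].
have cl : lift k e p (x t) @[t --> -oo] --> lift k e p (circle k p) by exact: cvg_lift.
have [T1 [_ T1P]] := near_facing cx fc.
pose T2 := Num.min T T1.
have dx2 t : t < T2 -> forall l, is_derive t 1 (fun u => x u 0 l) (field v k e (x t) 0 l).
  by rewrite lt_min => /andP[tT _] l; exact: dx.
have fx t : t < T2 -> facing k p (x t) by rewrite lt_min => /andP[_ /T1P].
have dr t : t < T2 -> forall i j, e i j -> is_derive t 1 (fun u => rho (lift k e p (x u)) i j)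
    (rho_dot v (lift k e p (x t)) i j).
  by move=> tT i j; exact: (is_derive_rho_lift e_sym e_irr (dx2 t tT) (fx t tT)).
have da t : t < T2 -> forall i j, e i j -> is_derive t 1 (fun u => alpha (lift k e p (x u)) i j)
    (alpha_dot v k e (lift k e p (x t)) i j).
  by move=> tT i j; exact: (is_derive_alpha_lift k_neq0 e_sym e_irr (dx2 t tT) (fx t tT)).
have inC t : t < T2 -> forall eps, 0 < eps -> neighborhood C eps (lift k e p (x t)).
  move=> tT eps /stab[dl dl0 dlP].
  have /cvg_ballP/(_ _ dl0)[M [_ MP]] := cl.
  (* A starting time before t and far enough back for the curve to be within [dl] of the formation;
     stability is applied to the solution restarted at [t2], of duration t - t2. *)
  pose t2 := Num.min t M - 1.
  have t2t : t2 < t by rewrite ltrBlDr (le_lt_trans (_ : _ <= t))// ?ge_min ?lexx// ltrDl.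
  have t2M : t2 < M by rewrite ltrBlDr (le_lt_trans (_ : _ <= M))// ?ge_min ?lexx ?orbT// ltrDl.
  have shift (f : R -> R) (df u : R) : is_derive (t2 + u) 1 f df ->
      is_derive u 1 (fun s => f (t2 + s)) df.
    move=> h; have hs : is_derive u 1 (fun s : R => t2 + s) 1.
      by apply: is_derive_eq (is_deriveD (is_derive_cst t2 u 1) (is_derive_id u 1)) _; rewrite add0r.
    by apply: is_derive_eq (is_derive1_comp (f := f) (g := fun s => t2 + s) h hs) _; rewrite mulr1.
  have ut u : u <= t - t2 -> t2 + u < T2.
    by move=> h; apply: le_lt_trans tT; rewrite addrC -lerBrDr.
  have := dlP (t - t2) (fun u => lift k e p (x (t2 + u))).
  rewrite subr_ge0 addr0 => /(_ (ltW t2t)) H.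
  rewrite -[t](subrKC t2); apply: H.
  - split.
    + apply: continuous_in_subspaceT => u; rewrite inE /= in_itv /= => /andP[_ /ut uT].
      apply: (cvg_lift (x := fun s => x (t2 + s)) (F := nbhs u) (y := x (t2 + u))); last exact: fx.
      by move=> l; exact: is_derive_continuous (shift _ _ _ (dx2 _ uT l)).
    + by move=> u; rewrite in_itv /= => /andP[_ /ut/fx]; exact: lift_manifold.
    + move=> u; rewrite in_itv /= => /andP[_ /ltW/ut uT] i j ij.
      split.
        exact: (shift (fun s => rho (lift k e p (x s)) i j) _ _ (dr _ uT _ _ ij)).
      exact: (shift (fun s => alpha (lift k e p (x s)) i j) _ _ (da _ uT _ _ ij)).
  - by exists (lift k e p (circle k p)) => //; exact: MP.
  - by rewrite in_itv /= lexx subr_ge0 ltW.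
(* Every point of the curve is adherent to C, so the edge coordinates have zero derivative and equal
   their limits at -oo. *)
have eq_lift t : t < T2 -> forall i j, e i j ->
    rho (lift k e p (x t)) i j = rho (lift k e p (circle k p)) i j /\
    alpha (lift k e p (x t)) i j = alpha (lift k e p (circle k p)) i j.
  move=> tT i j ij; split.
    apply: (derive0_limit _ (cvg_rho_lift (i := i) (j := j) cx) tT) => s sT.
    have [<- _] := adherent_equilibrium v e_sym e_irr C_sub (fx s sT) (inC s sT) ij.
    exact: dr.
  apply: (derive0_limit _ (cvg_alpha_lift (i := i) (j := j) cx fc) tT) => s sT.
  have [_ <-] := adherent_equilibrium v e_sym e_irr C_sub (fx s sT) (inC s sT) ij.
  exact: da.
have turn_x t : t < T2 -> forall i, turn v k e (x t) i = v / k.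
  move=> tT i; rewrite -(turn_circle v k_neq0 e_irr e_nbr sep i).
  rewrite -(omega_lift v e_sym e_irr i (fx t tT)) -(omega_lift v e_sym e_irr i fc).
  rewrite /omega; congr (_ * _); apply: eq_bigr => j ij.
  have ji : e j i by rewrite e_sym.
  have [-> ->] := eq_lift t tT i j ij; have [_ ->] := eq_lift t tT j i ji.
  by [].
(* The turning rate depends on edge coordinates only, so it is v / k along the curve and the
   headings stand still in the turning plane. *)
have heading_x t : t < T2 -> forall i, heading (x t) i = p i.
  move=> tT i; rewrite -[RHS](heading_node (fun i => k * sin (p i)) (fun i => - k * cos (p i)) p).
  apply: (derive0_limit _ (cx _) tT) => s sT.
  apply: is_derive_eq (is_derive_heading (dx2 s sT) i) _.
  by rewrite turn_x// subrr.
(* With the headings fixed, the deviation of a position from its place on the circle merely rotates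
   at the angular speed - v / k, and it tends to 0 at -oo. *)
have pos_x t : t < T2 -> forall i,
    posx (x t) i - k * sin (p i) = 0 /\ posy (x t) i - - k * cos (p i) = 0.
  move=> tT i.
  have du s : s < T2 -> is_derive s 1 (fun s => posx (x s) i - k * sin (p i))
      (v / k * (posy (x s) i - - k * cos (p i))).
    move=> sT; apply: is_derive_eq (is_deriveB (dx2 s sT _) (is_derive_cst _ _ _)) _.
    by rewrite -/(posx _ _) posx_node subr0 heading_x//; field.
  have dw s : s < T2 -> is_derive s 1 (fun s => posy (x s) i - - k * cos (p i))
      (- (v / k * (posx (x s) i - k * sin (p i)))).
    move=> sT; apply: is_derive_eq (is_deriveB (dx2 s sT _) (is_derive_cst _ _ _)) _.
    by rewrite -/(posy _ _) posy_node subr0 heading_x//; field.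
  have u0 : (posx (x s) i - k * sin (p i)) @[s --> -oo] --> (0 : R).
    rewrite -[X in _ --> X](subrr (k * sin (p i))); apply: cvgB; last exact: cvg_cst.
    by have := cx (lshift n (lshift n i)); rewrite -/(posx _ _) posx_node.
  have w0 : (posy (x s) i - - k * cos (p i)) @[s --> -oo] --> (0 : R).
    rewrite -[X in _ --> X](subrr (- k * cos (p i))); apply: cvgB; last exact: cvg_cst.
    by have := cx (lshift n (rshift n i)); rewrite -/(posy _ _) posy_node.
  exact: (rotation_limit du dw u0 w0 tT).
have [t tT /eqP] := xnc T2; apply; apply/rowP => l.
case: (split_ordP l) => [l' ->|i ->]; last first.
  by rewrite -!/(heading _ _) heading_x// heading_node.
case: (split_ordP l') => [i ->|i ->].
  by rewrite -!/(posx _ _) posx_node; apply/eqP; rewrite -subr_eq0; apply/eqP; have [] := pos_x t tT i.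
by rewrite -!/(posy _ _) posy_node; apply/eqP; rewrite -subr_eq0; apply/eqP; have [] := pos_x t tT i.
Qed.

End Instability.

Theorem theorem27 (R : realType) (n : nat) (hn : (2 <= n)%N)
  (v k : R) (hv : 0 < v) (hk : k != 0)
  (e : rel 'I_n) (he : connected_graph e) :
  [/\ unstable v k e (Cplus k e),
      0 < k -> unstable v k e (counterclockwise_formations e) &
      k < 0 -> unstable v k e (clockwise_formations e)].
Proof.
have [e_sym e_irr e_conn] := he.
have n0 : (0 < n)%N by apply: leq_trans hn.
have e_nbr i : exists j, e i j.
  pose a := Ordinal n0; pose b := Ordinal hn.
  (* As n >= 2 there is some j other than i; the first vertex on a path from i to j is a neighbor of
     i. *)
  have [j ij] : exists j, i != j.
    have [->|ia] := eqVneq i a; [by exists b|by exists a].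
  have /connectP[[|c s] /= path_s last_s] := e_conn i j.
    by move: ij; rewrite last_s eqxx.
  by exists c; move: path_s => /andP[].
have [p [pI pc sl]] := exists_phases v k e.
have XiC := Xi_circle hk e_sym e_irr pI pc.
have ratio := ratio_circle hk e_irr pI pc.
(* One formation serves all three sets: its ratio 1 / (2 k) has the sign of k. *)
have main C : C `<=` Xi e -> C (lift k e p (circle k p)) -> unstable v k e C.
  exact: unstable_formations.
split=> [|k0|k0]; apply: main; try by move=> c [].
- split=> //; exists (1 / (2 * k)) => //.
  by rewrite (_ : k * _ = 1 / 2) ?divr_gt0//; field.
- by split=> //; exists (1 / (2 * k)) => //; rewrite divr_gt0// mulr_gt0.
- by split=> //; exists (1 / (2 * k)) => //; rewrite mul1r invr_lt0 pmulr_rlt0.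
Qed.
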